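(* Let $E,Q\in M_n(\mathbb C)$ and assume that at least one of $E$ and $Q$ is nonsingular. Then there exist $U,V\in GL_n(\mathbb C)$ such that, if $E$ is nonsingular, $$(UEV,U^{-T}QV)=\Big(I_n,\ \big(\bigoplus_{i=1}^{p}H_{2m_i}(\mu_i)\big)\oplus\big(\bigoplus_{j=1}^{q}\Gamma_{n_j}\big)\oplus\big(\bigoplus_{k=1}^{r}J_{r_k}(0)\big)\Big),$$ and, if $Q$ is nonsingular, $$(UEV,U^{-T}QV)=\Big(I_{n-v}\oplus\big(\bigoplus_{k=1}^{r}J_{r_k}(0)^T\big),\ \big(\bigoplus_{i=1}^{p}H_{2m_i}(\mu_i)\big)\oplus\big(\bigoplus_{j=1}^{q}\Gamma_{n_j}\big)\oplus I_v\Big),$$ where $v=\sum_{k=1}^{r}r_k$, $0\neq\mu_i\neq(-1)^{m_i+1}$ for every $i$, and each $\mu_i$ is determined up to replacement by $\mu_i^{-1}$. In each case the canonical form is uniquely determined by $(E,Q)$ up to permutations of pairs of summands (and the replacements $\mu_i\mapsto\mu_i^{-1}$).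
   Context: $M_n(\mathbb C)$ is the set of $n\times n$ complex matrices, $GL_n(\mathbb C)$ the nonsingular ones, $A^{-T}=(A^{-1})^T$. $\oplus$ is the block-diagonal direct sum; any of the families of summands may be empty ($p,q,r\ge 0$). $J_n(\lambda)$ is the $n\times n$ upper Jordan block with eigenvalue $\lambda$ (ones on the superdiagonal). $\Gamma_n$ is the $n\times n$ matrix whose nonzero entries are: in row $n+1-j$, the entry $(-1)^{j+1}$ in column $j$ (for $1\le j\le n$) and also in column $j+1$ (for $1\le j\le n-1$); $\Gamma_1=[1]$, $\Gamma_2=\begin{bmatrix}0&-1\\ 1&1\end{bmatrix}$. $H_{2n}(\mu)=\begin{bmatrix}0&I_n\\ J_n(\mu)&0\end{bmatrix}$. The pairs of summands are $(I_{2m_i},H_{2m_i}(\mu_i))$, $(I_{n_j},\Gamma_{n_j})$, and $(I_{r_k},J_{r_k}(0))$ (respectively $(J_{r_k}(0)^T,I_{r_k})$). *)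

(* Defs.v *)
From HB Require Import structures.
From mathcomp Require Import all_boot all_order all_algebra.
From mathcomp Require Export complex reals.

Set Implicit Arguments.
Unset Strict Implicit.
Unset Printing Implicit Defensive.

Import GRing.Theory.
Local Open Scope ring_scope.

Section CanonicalForms.

Variable F : fieldType.

Definition jordan (n : nat) (a : F) : 'M[F]_n :=
  \matrix_(i, j) (if i == j :> nat then a
                  else if i.+1 == j :> nat then 1 else 0).

(* With 0-based indices, row i has the entry (-1)^k in columns k and k+1
   (when these are < n), where k = n - 1 - i. *)
Definition Gamma (n : nat) : 'M[F]_n :=
  \matrix_(i, j) (if (rev_ord i == j :> nat) || ((rev_ord i).+1 == j :> nat)
                  then (-1) ^+ rev_ord i else 0).

Definition Hmx (m : nat) (mu : F) : 'M[F]_(m + m) :=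
  block_mx 0 1%:M (jordan m mu) 0.

Definition dsum (m n : nat) (A : 'M[F]_m) (B : 'M[F]_n) : 'M[F]_(m + n) :=
  block_mx A 0 0 B.

Record canon_data := CanonData {
  cp : nat;
  cm : 'I_cp -> nat;
  cmu : 'I_cp -> F;
  cq : nat;
  cn : 'I_cq -> nat;
  cr : nat;
  crk : 'I_cr -> nat }.

Definition admissible (d : canon_data) : Prop :=
  [/\ forall i : 'I_(cp d), (0 < cm i)%N,
      forall j : 'I_(cq d), (0 < cn j)%N,
      forall k : 'I_(cr d), (0 < crk k)%N
    & forall i : 'I_(cp d), cmu i != 0 /\ cmu i != (-1) ^+ (cm i).+1].

Definition dim_reg (d : canon_data) : nat :=
  ((\sum_(i < cp d) (cm i + cm i)) + \sum_(j < cq d) cn j)%N.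

Definition dim_nil (d : canon_data) : nat := (\sum_(k < cr d) crk k)%N.

Definition cdim (d : canon_data) : nat := (dim_reg d + dim_nil d)%N.

Definition reg_part (d : canon_data) : 'M[F]_(dim_reg d) :=
  dsum (\mxdiag_(i < cp d) Hmx (cm i) (cmu i))
       (\mxdiag_(j < cq d) Gamma (cn j)).

Definition canon_E (d : canon_data) : 'M[F]_(cdim d) * 'M[F]_(cdim d) :=
  (1%:M, dsum (reg_part d) (\mxdiag_(k < cr d) jordan (crk k) 0)).

Definition canon_Q (d : canon_data) : 'M[F]_(cdim d) * 'M[F]_(cdim d) :=
  (dsum 1%:M (\mxdiag_(k < cr d) (jordan (crk k) 0)^T),
   dsum (reg_part d) 1%:M).

Definition cast_pair (m n : nat) (h : m = n) (P : 'M[F]_m * 'M[F]_m) :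
  'M[F]_n * 'M[F]_n :=
  (castmx (h, h) P.1, castmx (h, h) P.2).

Definition act (n : nat) (U V : 'M[F]_n) (P : 'M[F]_n * 'M[F]_n) :
  'M[F]_n * 'M[F]_n :=
  (U *m P.1 *m V, (invmx U)^T *m P.2 *m V).

Definition reduces_to (n : nat) (P : 'M[F]_n * 'M[F]_n) (m : nat)
  (S : 'M[F]_m * 'M[F]_m) : Prop :=
  exists (h : m = n) (U V : 'M[F]_n),
    [/\ U \in unitmx, V \in unitmx & act U V P = cast_pair h S].

(* The three families of summands of d and d' agree up to a permutation
   within each family and replacements of parameters mu by mu^-1. *)
Definition same_summands (d d' : canon_data) : Prop :=
  [/\ exists2 s : 'I_(cp d) -> 'I_(cp d'), bijective s &
        forall i, cm (s i) = cm i /\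
                  (cmu (s i) = cmu i \/ cmu (s i) = (cmu i)^-1),
      exists2 s : 'I_(cq d) -> 'I_(cq d'), bijective s &
        forall j, cn (s j) = cn j
    & exists2 s : 'I_(cr d) -> 'I_(cr d'), bijective s &
        forall k, crk (s k) = crk k].

End CanonicalForms.

(* Main.v *)
(* A change (E, Q) -> (U E V, U^-T Q V) that turns E into 1 is a congruence of
   Q E^-1, so the statement is the canonical form of square matrices under
   congruence; when only Q is invertible, use (E Q^-1)^T instead, because
   R^-1 is congruent to R^T.

   Existence. Let K be the left kernel of A. Passing from A to the form it
   induces on K^perp / K and lengthening the nilpotent chains found there shows
   by induction that A is congruent to an invertible R plus nilpotent Jordan
   blocks.  Two invertible matrices are congruent as soon as
   their cosquares A A^-T are similar: if the cosquares are equal, X = B A^-1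
   satisfies X A = A X^T, so a polynomial square root Y of X gives B = Y A Y^T.
   It remains to split R: a cyclic vector for an eigenvalue of the cosquare of
   maximal multiplicity spans, alone (Gamma) or with a dual partner (H), a
   subspace on which the form is nondegenerate.

   Uniqueness. The linear relation x (A - a A^T) = y A^T iterates 0 to a chain
   of subspaces whose dimensions are additive congruence invariants; for a = 0
   they count the nilpotent blocks, and for the other values of a the Jordan
   blocks of the cosquare. *)
Require Import Defs.
From mathcomp Require Import all_boot all_order all_algebra.
From mathcomp Require Import complex reals.
From mathcomp Require Import fingroup perm zify ring.
Import GRing.Theory.
Local Open Scope ring_scope.

Set Implicit Arguments.
Unset Strict Implicit.
Unset Printing Implicit Defensive.

(** * Congruence and direct sums *)

Section Congruence.
Variable F : fieldType.

Definition congruent m n (A : 'M[F]_m) (B : 'M[F]_n) : Prop :=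
  exists (S : 'M[F]_(m, n)) (T : 'M[F]_(n, m)),
    [/\ S *m T = 1%:M, T *m S = 1%:M & A = S *m B *m S^T].

Definition similar_mx m n (A : 'M[F]_m) (B : 'M[F]_n) : Prop :=
  exists (S : 'M[F]_(m, n)) (T : 'M[F]_(n, m)),
    [/\ S *m T = 1%:M, T *m S = 1%:M & A = S *m B *m T].

Lemma congruent_refl m (A : 'M[F]_m) : congruent A A.
Proof. by exists 1%:M, 1%:M; rewrite !mulmx1 trmx1 mulmx1 mul1mx. Qed.

Lemma congruent_sym m n (A : 'M[F]_m) (B : 'M[F]_n) :
  congruent A B -> congruent B A.
Proof.
move=> [S [T [ST TS ->]]]; exists T, S; split=> //.
by rewrite !mulmxA TS mul1mx -mulmxA -trmx_mul TS trmx1 mulmx1.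
Qed.

Lemma congruent_trans m n p (B : 'M[F]_n) (A : 'M[F]_m) (C : 'M[F]_p) :
  congruent A B -> congruent B C -> congruent A C.
Proof.
move=> [S [T [ST TS ->]]] [S' [T' [ST' TS' ->]]].
exists (S *m S'), (T' *m T); split; last by rewrite trmx_mul !mulmxA.
  by rewrite mulmxA -(mulmxA S) ST' mulmx1.
by rewrite mulmxA -(mulmxA T') TS mulmx1.
Qed.

Lemma similar_refl m (A : 'M[F]_m) : similar_mx A A.
Proof. by exists 1%:M, 1%:M; rewrite !mulmx1 mul1mx. Qed.

Lemma similar_sym m n (A : 'M[F]_m) (B : 'M[F]_n) : similar_mx A B -> similar_mx B A.
Proof.
move=> [S [T [ST TS ->]]]; exists T, S; split=> //.
by rewrite !mulmxA TS mul1mx -mulmxA TS mulmx1.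
Qed.

Lemma similar_trans m n p (B : 'M[F]_n) (A : 'M[F]_m) (C : 'M[F]_p) :
  similar_mx A B -> similar_mx B C -> similar_mx A C.
Proof.
move=> [S [T [ST TS ->]]] [S' [T' [ST' TS' ->]]].
exists (S *m S'), (T' *m T); split; last by rewrite !mulmxA.
  by rewrite mulmxA -(mulmxA S) ST' mulmx1.
by rewrite mulmxA -(mulmxA T') TS mulmx1.
Qed.

Lemma mulmx1_eq_dim m n (S : 'M[F]_(m, n)) (T : 'M[F]_(n, m)) :
  S *m T = 1%:M -> T *m S = 1%:M -> m = n.
Proof. by move=> /mulmx1_min h1 /mulmx1_min h2; apply/eqP; rewrite eqn_leq h1. Qed.

Lemma congruent_dim m n (A : 'M[F]_m) (B : 'M[F]_n) : congruent A B -> m = n.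
Proof. by move=> [S [T [/mulmx1_eq_dim + /[swap] _]]]; apply. Qed.

Lemma congruent_cast m n (h : m = n) (A : 'M[F]_m) :
  congruent (castmx (h, h) A) A.
Proof. by case: _ / h; rewrite castmx_id; apply: congruent_refl. Qed.

Lemma congruent_tr m n (A : 'M[F]_m) (B : 'M[F]_n) :
  congruent A B -> congruent A^T B^T.
Proof.
move=> [S [T [ST TS ->]]]; exists S, T; split=> //.
by rewrite !trmx_mul trmxK !mulmxA.
Qed.

Lemma congruent_free_full m n (S : 'M[F]_(m, n)) (A : 'M[F]_n) :
  row_free S -> row_full S -> congruent (S *m A *m S^T) A.
Proof.
by move=> h1 h2; exists S, (pinvmx S); rewrite mulmxVp ?mulVpmx.
Qed.

Lemma congruent_unit m n (A : 'M[F]_m) (B : 'M[F]_n) :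
  congruent A B -> (A \in unitmx) = (B \in unitmx).
Proof.
suff h m' n' (A' : 'M[F]_m') (B' : 'M[F]_n') :
    congruent A' B' -> B' \in unitmx -> A' \in unitmx.
  by move=> c; apply/idP/idP; apply: h => //; apply: congruent_sym.
move=> [S [T [ST TS ->]]] uB.
have e := mulmx1_eq_dim ST TS.
case: _ / e B' S T ST TS uB => B' S T ST TS uB.
have [uS _] := mulmx1_unit ST.
by rewrite !unitmx_mul uS uB unitmx_tr.
Qed.

Lemma congruent_dsum m n m' n' (A : 'M[F]_m) (B : 'M[F]_n)
  (A' : 'M[F]_m') (B' : 'M[F]_n') :
  congruent A B -> congruent A' B' -> congruent (dsum A A') (dsum B B').
Proof.
move=> [S [T [ST TS ->]]] [S' [T' [ST' TS' ->]]].
exists (block_mx S 0 0 S'), (block_mx T 0 0 T').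
rewrite /dsum tr_block_mx !trmx0 !mulmx_block !(mulmx0, mul0mx, addr0, add0r).
by split=> //; rewrite ?ST ?ST' ?TS ?TS' -?scalar_mx_block.
Qed.

Lemma similar_dsum m n m' n' (A : 'M[F]_m) (B : 'M[F]_n)
  (A' : 'M[F]_m') (B' : 'M[F]_n') :
  similar_mx A B -> similar_mx A' B' -> similar_mx (dsum A A') (dsum B B').
Proof.
move=> [S [T [ST TS ->]]] [S' [T' [ST' TS' ->]]].
exists (block_mx S 0 0 S'), (block_mx T 0 0 T').
rewrite /dsum !mulmx_block !(mulmx0, mul0mx, addr0, add0r).
by split=> //; rewrite ?ST ?ST' ?TS ?TS' -?scalar_mx_block.
Qed.

Lemma similar_dsumC m n (A : 'M[F]_m) (B : 'M[F]_n) :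
  similar_mx (dsum A B) (dsum B A).
Proof.
exists (block_mx 0 1%:M 1%:M 0), (block_mx 0 1%:M 1%:M 0).
rewrite /dsum !mulmx_block !(mulmx0, mul0mx, addr0, add0r) !mulmx1 !mul1mx.
by split=> //; rewrite -scalar_mx_block.
Qed.

Lemma dsum_unit m n (A : 'M[F]_m) (B : 'M[F]_n) :
  (dsum A B \in unitmx) = (A \in unitmx) && (B \in unitmx).
Proof. by rewrite !unitmxE det_ublock unitrM. Qed.

Lemma invmx_dsum m n (A : 'M[F]_m) (B : 'M[F]_n) :
  A \in unitmx -> B \in unitmx -> invmx (dsum A B) = dsum (invmx A) (invmx B).
Proof.
move=> uA uB; have uAB : dsum A B \in unitmx by rewrite dsum_unit uA.
apply: (can_inj (mulKmx uAB)); rewrite mulmxV // /dsum mulmx_block.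
by rewrite !mulmxV // !(mulmx0, mul0mx, addr0, add0r) -scalar_mx_block.
Qed.

Lemma tr_dsum m n (A : 'M[F]_m) (B : 'M[F]_n) : (dsum A B)^T = dsum A^T B^T.
Proof. by rewrite /dsum tr_block_mx !trmx0. Qed.

Lemma mul_dsum m n (A A' : 'M[F]_m) (B B' : 'M[F]_n) :
  dsum A B *m dsum A' B' = dsum (A *m A') (B *m B').
Proof. by rewrite /dsum mulmx_block !(mulmx0, mul0mx, addr0, add0r). Qed.

Lemma dsum1 m n : dsum 1%:M 1%:M = 1%:M :> 'M[F]_(m + n).
Proof. by rewrite /dsum -scalar_mx_block. Qed.

Definition jsum (T1 T2 : Type) m n (e1 : T1 -> 'I_m) (e2 : T2 -> 'I_n)
    (x : T1 + T2) : 'I_(m + n) :=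
  match x with inl a => lshift n (e1 a) | inr b => rshift m (e2 b) end.

Lemma jsum_bij (T1 T2 : Type) m n (e1 : T1 -> 'I_m) (e2 : T2 -> 'I_n) :
  bijective e1 -> bijective e2 -> bijective (jsum e1 e2).
Proof.
move=> [f1 k1 k1'] [f2 k2 k2'].
exists (fun i => match split i with inl a => inl (f1 a) | inr b => inr (f2 b) end).
  case=> x /=.
    by rewrite -[lshift _ _]/(unsplit (inl (e1 x))) unsplitK k1.
  by rewrite -[rshift _ _]/(unsplit (inr (e2 x))) unsplitK k2.
by move=> i; case: (split_ordP i) => j -> /=; rewrite (k1', k2').
Qed.

Lemma id_bij (T : Type) : bijective (@id T).
Proof. by exists id. Qed.

Lemma congruent_reindex (T : Type) m n (A : 'M[F]_m) (B : 'M[F]_n)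
  (e : T -> 'I_m) (e' : T -> 'I_n) : bijective e -> bijective e' ->
  (forall x y, A (e x) (e y) = B (e' x) (e' y)) -> congruent A B.
Proof.
move=> [f k k'] [f' l l'] hAB.
have ee i j : (e (f' j) == i) = (e' (f i) == j).
  by apply/eqP/eqP => <-; rewrite ?k ?l ?k' ?l'.
exists (\matrix_(i, j) (e (f' j) == i)%:R), (\matrix_(i, j) (e' (f j) == i)%:R).
split; apply/matrixP=> i j; rewrite !mxE.
- rewrite (bigD1 (e' (f j))) //= !mxE l k' eqxx mulr1 big1 ?addr0 1?eq_sym //.
  by move=> z zj; rewrite !mxE [_ == z]eq_sym (negPf zj) mulr0.
- rewrite (bigD1 (e (f' j))) //= !mxE k l' eqxx mulr1 big1 ?addr0 1?eq_sym //.
  by move=> z zj; rewrite !mxE [_ == z]eq_sym (negPf zj) mulr0.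
- rewrite (bigD1 (e' (f j))) //= !mxE l k' eqxx mulr1 [X in _ + X]big1 ?addr0.
    rewrite (bigD1 (e' (f i))) //= !mxE l k' eqxx mul1r big1 ?addr0.
      by rewrite -hAB !k'.
    by move=> z zj; rewrite !mxE ee eq_sym (negPf zj) mul0r.
  by move=> z zj; rewrite !mxE ee [_ == z]eq_sym (negPf zj) mulr0.
Qed.

Lemma congruent_dsumC m n (A : 'M[F]_m) (B : 'M[F]_n) :
  congruent (dsum A B) (dsum B A).
Proof.
apply: (@congruent_reindex _ _ _ _ _ (jsum id id)
  (jsum id id \o fun x => match x with inl a => inr a | inr b => inl b end)).
- exact/jsum_bij/id_bij/id_bij.
- by apply: bij_comp; [exact/jsum_bij/id_bij/id_bij|
    exists (fun x => match x with inl a => inr a | inr b => inl b end); case].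
- by case=> x [] y /=;
    rewrite ?(block_mxEul, block_mxEur, block_mxEdl, block_mxEdr).
Qed.

Lemma congruent_dsumA m n p (A : 'M[F]_m) (B : 'M[F]_n) (C : 'M[F]_p) :
  congruent (dsum A (dsum B C)) (dsum (dsum A B) C).
Proof.
apply: (@congruent_reindex _ _ _ _ _ (jsum id (jsum id id))
  (jsum (jsum id id) id \o fun x => match x with
    inl a => inl (inl a) | inr (inl b) => inl (inr b) | inr (inr b) => inr b end)).
- by do !apply: jsum_bij; apply: id_bij.
- apply: bij_comp; first by do !apply: jsum_bij; apply: id_bij.
  by exists (fun x => match x with
    inl (inl a) => inl a | inl (inr b) => inr (inl b) | inr b => inr (inr b) end);
   [case=> [x|[x|x]] | case=> [[x|x]|x]].
- by case=> [x|[x|x]] [y|[y|y]] /=;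
    rewrite ?(block_mxEul, block_mxEur, block_mxEdl, block_mxEdr, mxE).
Qed.

Lemma congruent_dim0 m n (A : 'M[F]_m) (B : 'M[F]_n) :
  m = 0%N -> n = 0%N -> congruent A B.
Proof.
move=> m0 n0; subst m n.
by rewrite [A]flatmx0 [B]flatmx0; apply: congruent_refl.
Qed.

Lemma congruent_dsum0 m n (A : 'M[F]_m) (B : 'M[F]_n) :
  n = 0%N -> congruent A (dsum A B).
Proof.
move=> n0; subst n.
apply: (@congruent_reindex _ _ _ _ _ id (lshift 0)); first exact: id_bij.
  by apply: inj_card_bij; [apply: lshift_inj | rewrite !card_ord addn0].
by move=> x y; rewrite block_mxEul.
Qed.

Section ListSum.
Variables (T : Type) (d : T -> nat) (M : forall t, 'M[F]_(d t)).

Fixpoint bdim (s : seq T) : nat := if s is t :: s' then d t + bdim s' else 0.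

Fixpoint bdiag (s : seq T) : 'M[F]_(bdim s) :=
  if s is t :: s' return 'M[F]_(bdim s) then dsum (M t) (bdiag s') else 0.

Lemma bdiag_cat s s' :
  congruent (bdiag (s ++ s')) (dsum (bdiag s) (bdiag s')).
Proof.
elim: s => [|t s IH] /=.
  apply: congruent_trans (congruent_dsumC _ _); exact: congruent_dsum0.
apply: congruent_trans (congruent_dsumA _ _ _).
by apply: congruent_dsum => //; apply: congruent_refl.
Qed.

End ListSum.

Lemma bdiag_perm (T : eqType) (d : T -> nat) (M : forall t, 'M[F]_(d t)) s s' :
  perm_eq s s' -> congruent (bdiag M s) (bdiag M s').
Proof.
elim: s s' => [|t s IH] s' /=.
  by rewrite perm_sym => /perm_nilP ->; apply: congruent_refl.
move=> h; have ts' : t \in s' by rewrite -(perm_mem h) mem_head.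
case/splitPr: ts' h => s1 s2; rewrite perm_sym => h.
have {}h : perm_eq (s1 ++ [:: t] ++ s2) (t :: s) by [].
move: h; rewrite perm_catCA perm_cons perm_sym => /IH {}IH.
apply: (congruent_trans _ (congruent_sym (bdiag_cat _ _ _))) => /=.
apply: (congruent_trans _ (congruent_sym (congruent_dsumA _ _ _))).
apply: (congruent_trans _
  (congruent_dsum (congruent_dsumC _ _) (congruent_refl _))).
apply: (congruent_trans _ (congruent_dsumA _ _ _)).
apply: congruent_dsum (congruent_refl _) _.
exact: congruent_trans IH (bdiag_cat _ _ _).
Qed.

Lemma bdiag_congr (T T' : Type) (d : T -> nat) (M : forall t, 'M[F]_(d t))
  (d' : T' -> nat) (M' : forall t, 'M[F]_(d' t)) (f : T -> T') s :
  (forall t, congruent (M t) (M' (f t))) ->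
  congruent (bdiag M s) (bdiag M' [seq f i | i <- s]).
Proof.
move=> h; elim: s => [|t s IH] /=; first exact: congruent_refl.
exact: congruent_dsum.
Qed.

Lemma mxdiag_bdiag p (d : 'I_p -> nat) (M : forall i, 'M[F]_(d i)) :
  congruent (\mxdiag_(i < p) M i) (bdiag M (enum 'I_p)).
Proof.
elim: p d M => [|p IH] d M.
  apply: congruent_dim0; first by rewrite big_ord0.
  by rewrite (size0nil (size_enum_ord 0)).
rewrite mxdiag_recl; apply: congruent_trans (congruent_cast _ _) _.
rewrite enum_ordSl /=; apply: congruent_dsum (congruent_refl _) _.
apply: congruent_trans (IH _ _) _.
by apply: bdiag_congr => t; apply: congruent_refl.
Qed.

Lemma mxdiag_congr p p' (d : 'I_p -> nat) (M : forall i, 'M[F]_(d i))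
  (d' : 'I_p' -> nat) (M' : forall i, 'M[F]_(d' i)) (f : 'I_p -> 'I_p') :
  bijective f -> (forall i, congruent (M i) (M' (f i))) ->
  congruent (\mxdiag_(i < p) M i) (\mxdiag_(i < p') M' i).
Proof.
move=> bf h; apply: congruent_trans (mxdiag_bdiag _) _.
apply: (congruent_trans _ (congruent_sym (mxdiag_bdiag _))).
apply: congruent_trans (bdiag_congr _ h) _; apply: bdiag_perm.
apply: uniq_perm; rewrite ?(map_inj_uniq (bij_inj bf)) ?enum_uniq // => i.
by rewrite mem_enum; case: bf => g _ fg; rewrite -(fg i) map_f ?mem_enum.
Qed.

End Congruence.

(** * Splitting off the nilpotent part *)

Section Regularization.
Variable F : fieldType.

(* The shape of a form whose left kernel K (last block) pairs perfectly with a
   complement of K^perp (middle block); A is the form induced on K^perp / K. *)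
Definition ext n m (A : 'M[F]_n) (B : 'M[F]_(n, m)) : 'M[F]_(n + (m + m)) :=
  block_mx A (row_mx B 0) 0 (block_mx 0 1%:M 0 0).

Lemma ext_clear n m (A : 'M[F]_n) (B : 'M[F]_(n, m)) (C : 'M_(m, n)) (D : 'M_m) :
  congruent (block_mx A (row_mx B 0) (col_mx C 0) (block_mx D 1%:M 0 0)) (ext A B).
Proof.
apply: congruent_sym.
exists (block_mx 1%:M (row_mx 0 (- C^T)) 0 (block_mx 1%:M (- D^T) 0 1%:M)),
       (block_mx 1%:M (row_mx 0 C^T) 0 (block_mx 1%:M D^T 0 1%:M)).
rewrite /ext !(tr_block_mx, tr_row_mx, trmx0, trmx1, linearN, trmxK) /=.
rewrite !(mulmx_block, mul_row_block, mul_row_col, mul_block_col).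
rewrite !(mulmx0, mul0mx, addr0, add0r, mulmx1, mul1mx, add_row_mx).
rewrite !trmxK !(mulmx_block, mul_row_block, mul_row_col, mul_block_col).
rewrite !(mulmx0, mul0mx, addr0, add0r, mulmx1, mul1mx, mulmxN, subrr, addNr).
by rewrite row_mx0 add_col_mx addr0 subrr col_mx0 -!scalar_mx_block.
Qed.

Lemma ext_congr n m n' m' (A : 'M[F]_n) (A' : 'M[F]_n') (B' : 'M_(n', m'))
  (S : 'M_(n, n')) (T : 'M_(n', n)) (M : 'M_(m', m)) (M' : 'M_(m, m')) :
  S *m T = 1%:M -> T *m S = 1%:M -> M *m M' = 1%:M -> M' *m M = 1%:M ->
  A = S *m A' *m S^T -> congruent (ext A (S *m B' *m M)) (ext A' B').
Proof.
move=> ST TS MM MM' ->.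
exists (block_mx S 0 0 (block_mx M^T 0 0 M')),
       (block_mx T 0 0 (block_mx M'^T 0 0 M)).
rewrite /ext !(tr_block_mx, trmx0, trmxK).
rewrite !(mulmx_block, mul_mx_row, mul_row_block, mulmx0, mul0mx, addr0, add0r).
rewrite !(mulmx1, mul1mx) ST TS MM MM' -!trmx_mul MM MM' trmx1.
by split; rewrite ?trmx1 -?scalar_mx_block.
Qed.

Lemma ext_addmul n m (A : 'M[F]_n) (B X : 'M[F]_(n, m)) :
  congruent (ext A (B + A *m X)) (ext A B).
Proof.
apply: congruent_trans (congruent_sym (ext_clear _ _ (X^T *m A)
  (X^T *m (B + A *m X)))) _.
exists (block_mx 1%:M 0 (col_mx X^T 0) 1%:M),
       (block_mx 1%:M 0 (col_mx (- X^T) 0) 1%:M).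
rewrite /ext !(tr_block_mx, tr_col_mx, trmx0, trmx1, trmxK).
rewrite !(mulmx_block, mul_mx_row, mul_row_block, mul_col_row).
rewrite !(mulmx0, mul0mx, addr0, add0r, mulmx1, mul1mx,
  add_row_mx, mul_col_mx, add_col_mx).
rewrite !(subrr, addNr, col_mx0) -!scalar_mx_block.
split=> //.
have rowE (Y : 'M[F]_m) : row_mx (col_mx Y (0 : 'M_m)) 0 = block_mx Y 0 0 0.
  by rewrite block_mxEh col_mx0.
rewrite !rowE !add_block_mx !(addr0, add0r) mulmxDr mulmxA addrC.
by rewrite [X in _ = block_mx _ _ _ (block_mx X _ _ _)]addrC [A *m X + B]addrC.
Qed.

Lemma ext_row0 n l k (A : 'M[F]_n) (B : 'M_(n, l)) :
  congruent (ext A (row_mx B (0 : 'M_(n, k))))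
            (dsum (ext A B) (block_mx 0 1%:M 0 0 : 'M_(k + k))).
Proof.
pose h (x : 'I_n + (('I_l + 'I_k) + ('I_l + 'I_k))) :=
  match x with
  | inl a => inl (inl a)
  | inr (inl (inl a)) => inl (inr (inl a))
  | inr (inl (inr a)) => inr (inl a)
  | inr (inr (inl a)) => inl (inr (inr a))
  | inr (inr (inr a)) => inr (inr a)
  end : ('I_n + ('I_l + 'I_l)) + ('I_k + 'I_k).
pose h' (x : ('I_n + ('I_l + 'I_l)) + ('I_k + 'I_k)) :=
  match x with
  | inl (inl a) => inl a
  | inl (inr (inl a)) => inr (inl (inl a))
  | inr (inl a) => inr (inl (inr a))
  | inl (inr (inr a)) => inr (inr (inl a))
  | inr (inr a) => inr (inr (inr a))
  end : 'I_n + (('I_l + 'I_k) + ('I_l + 'I_k)).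
apply: (@congruent_reindex _ _ _ _ _ _
  (jsum id (jsum (jsum id id) (jsum id id)))
  (jsum (jsum id (jsum id id)) (jsum id id) \o h)).
- by do !apply: jsum_bij; apply: id_bij.
- apply: bij_comp; first by do !apply: jsum_bij; apply: id_bij.
  by exists h'; [case=> [x|[[x|x]|[x|x]]] | case=> [[x|[x|x]]|[x|x]]].
- by case=> [x|[[x|x]|[x|x]]] [y|[[y|y]|[y|y]]] /=;
    rewrite ?(block_mxEul, block_mxEur, block_mxEdl, block_mxEdr, row_mxEl,
      row_mxEr, mxE) ?(eq_lshift, eq_rshift, eq_lrshift, eq_rlshift).
Qed.

Lemma ext_dsum n m n' m' (A : 'M[F]_n) (B : 'M_(n, m))
  (A' : 'M[F]_n') (B' : 'M_(n', m')) :
  congruent (ext (dsum A A') (block_mx B 0 0 B')) (dsum (ext A B) (ext A' B')).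
Proof.
pose h (x : ('I_n + 'I_n') + (('I_m + 'I_m') + ('I_m + 'I_m'))) :=
  match x with
  | inl (inl a) => inl (inl a)
  | inl (inr a) => inr (inl a)
  | inr (inl (inl a)) => inl (inr (inl a))
  | inr (inl (inr a)) => inr (inr (inl a))
  | inr (inr (inl a)) => inl (inr (inr a))
  | inr (inr (inr a)) => inr (inr (inr a))
  end : ('I_n + ('I_m + 'I_m)) + ('I_n' + ('I_m' + 'I_m')).
pose h' (x : ('I_n + ('I_m + 'I_m)) + ('I_n' + ('I_m' + 'I_m'))) :=
  match x with
  | inl (inl a) => inl (inl a)
  | inr (inl a) => inl (inr a)
  | inl (inr (inl a)) => inr (inl (inl a))
  | inr (inr (inl a)) => inr (inl (inr a))
  | inl (inr (inr a)) => inr (inr (inl a))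
  | inr (inr (inr a)) => inr (inr (inr a))
  end : ('I_n + 'I_n') + (('I_m + 'I_m') + ('I_m + 'I_m')).
apply: (@congruent_reindex _ _ _ _ _ _
  (jsum (jsum id id) (jsum (jsum id id) (jsum id id)))
  (jsum (jsum id (jsum id id)) (jsum id (jsum id id)) \o h)).
- by do !apply: jsum_bij; apply: id_bij.
- apply: bij_comp; first by do !apply: jsum_bij; apply: id_bij.
  by exists h'; [case=> [[x|x]|[[x|x]|[x|x]]] | case=> [[x|[x|x]]|[x|[x|x]]]].
- by case=> [[x|x]|[[x|x]|[x|x]]] [[y|y]|[[y|y]|[y|y]]] /=;
    rewrite ?(block_mxEul, block_mxEur, block_mxEdl, block_mxEdr, row_mxEl,
      row_mxEr, mxE) ?(eq_lshift, eq_rshift, eq_lrshift, eq_rlshift).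
Qed.

Lemma ext_dsuml r n m (R : 'M[F]_r) (A : 'M[F]_n) (B : 'M_(n, m)) :
  congruent (ext (dsum R A) (col_mx 0 B)) (dsum R (ext A B)).
Proof.
pose h (x : ('I_r + 'I_n) + ('I_m + 'I_m)) :=
  match x with
  | inl (inl a) => inl a | inl (inr a) => inr (inl a)
  | inr a => inr (inr a)
  end : 'I_r + ('I_n + ('I_m + 'I_m)).
pose h' (x : 'I_r + ('I_n + ('I_m + 'I_m))) :=
  match x with
  | inl a => inl (inl a) | inr (inl a) => inl (inr a)
  | inr (inr a) => inr a
  end : ('I_r + 'I_n) + ('I_m + 'I_m).
apply: (@congruent_reindex _ _ _ _ _ _
  (jsum (jsum id id) (jsum id id)) (jsum id (jsum id (jsum id id)) \o h)).
- by do !apply: jsum_bij; apply: id_bij.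
- apply: bij_comp; first by do !apply: jsum_bij; apply: id_bij.
  by exists h'; [case=> [[x|x]|x] | case=> [x|[x|x]]].
- by case=> [[x|x]|[x|x]] [[y|y]|[y|y]] /=;
    rewrite ?(block_mxEul, block_mxEur, block_mxEdl, block_mxEdr, row_mxEl,
      row_mxEr, col_mxEu, col_mxEd, mxE).
Qed.

Lemma jordan0E n (i j : 'I_n) : jordan n (0 : F) i j = (i.+1 == j)%:R.
Proof.
rewrite mxE; case: eqP => [->|_]; first by rewrite eqn_leq ltnn.
by case: eqP.
Qed.

Definition Jsum (js : seq nat) := bdiag (fun r => jordan r (0 : F)) js.

Definition last_col r : 'M[F]_(r, 1) := \matrix_(i, j) (i.+1 == r)%:R.

Fixpoint last_cols (js : seq nat) : 'M[F]_(bdim id js, size js) :=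
  if js is r :: js' return 'M[F]_(bdim id js, size js)
  then block_mx (last_col r) 0 0 (last_cols js') else 0.

Lemma ext_jordan r :
  congruent (ext (jordan r (0 : F)) (last_col r)) (jordan r.+2 0).
Proof.
have e : (r + (1 + 1) = r.+2)%N by rewrite !addnS addn0.
apply: (congruent_trans (congruent_sym (congruent_cast e _))).
rewrite (_ : castmx _ _ = jordan r.+2 0); first exact: congruent_refl.
apply/matrixP=> i j; rewrite castmxE jordan0E /ext.
have hi : i = cast_ord (esym e) i :> nat by [].
have hj : j = cast_ord (esym e) j :> nat by [].
rewrite {}hi {}hj; move: (cast_ord _ i) (cast_ord _ j) => {}i {}j.
case: (split_ordP i) => [i1|i2] ->; case: (split_ordP j) => [j1|j2] ->;
  rewrite ?(block_mxEul, block_mxEur, block_mxEdl, block_mxEdr, jordan0E) //=.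
- case: (split_ordP j2) => k ->; rewrite ?(row_mxEl, row_mxEr, mxE) /= ?ord1 /=.
    by rewrite addn0.
  by rewrite addn1 eqSS (ltn_eqF (ltn_ord i1)).
- by rewrite mxE gtn_eqF // ltnS (leq_trans (ltnW (ltn_ord j1))) ?leq_addr.
- case: (split_ordP i2) => k ->; case: (split_ordP j2) => l ->;
    rewrite ?(block_mxEul, block_mxEur, block_mxEdl, block_mxEdr) ?mxE !ord1 /=;
    by rewrite ?addn0 ?addn1 ?eqxx // gtn_eqF.
Qed.

Lemma jordan_last r (r0 : (0 < r)%N) :
  [/\ jordan r 0 *m (jordan r 0)^T + last_col r *m (last_col r)^T = 1%:M,
      (last_col r)^T *m jordan r 0 = 0 & (last_col r)^T *m last_col r = 1%:M].
Proof.
split; apply/matrixP=> i j; rewrite !mxE.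
- rewrite big_ord1 !mxE; under eq_bigr => k _ do rewrite [_^T _ _]mxE !jordan0E.
  case: (ltngtP i.+1 r) (ltn_ord i) => // [lt _|er _].
    rewrite (bigD1 (Ordinal lt)) //= eqxx mul1r mul0r addr0 eqSS big1 ?addr0.
      by rewrite eq_sym.
    move=> k; rewrite -val_eqE /= eq_sym => /negPf ->; exact: mul0r.
  rewrite mul1r big1 ?add0r; first by rewrite -[X in _ == X]er eqSS eq_sym.
  by move=> k _; rewrite er gtn_eqF ?mul0r.
- under eq_bigr => k _ do rewrite jordan0E !mxE; rewrite big1 // => k _.
  case: eqP => [->|_]; last exact: mul0r.
  by rewrite gtn_eqF ?mulr0.
- have lt : (r.-1 < r)%N by rewrite prednK.
  rewrite !ord1 (bigD1 (Ordinal lt)) //= !mxE /= prednK // eqxx mulr1 big1 ?addr0 //.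
  move=> k; rewrite -val_eqE /= => h; rewrite !mxE.
  have -> : (k.+1 == r) = false.
    by apply: contraNF h => /eqP e; rewrite -[X in _ == X.-1]e.
  exact: mul0r.
Qed.

Lemma dsum_complement r n k l (J : 'M[F]_r) (z : 'M_(r, k)) (N : 'M_n)
  (Z : 'M_(n, l)) :
  [/\ J *m J^T + z *m z^T = 1%:M, z^T *m J = 0 & z^T *m z = 1%:M] ->
  [/\ N *m N^T + Z *m Z^T = 1%:M, Z^T *m N = 0 & Z^T *m Z = 1%:M] ->
  let D := dsum J N in let Y := block_mx z 0 0 Z in
  [/\ D *m D^T + Y *m Y^T = 1%:M, Y^T *m D = 0 & Y^T *m Y = 1%:M].
Proof.
move=> [h1 h2 h3] [k1 k2 k3] /=.
rewrite tr_dsum mul_dsum tr_block_mx !trmx0 /dsum !mulmx_block.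
rewrite !(mulmx0, mul0mx, addr0, add0r) h2 k2 h3 k3 block_mx0.
by rewrite add_block_mx !addr0 h1 k1 -!scalar_mx_block.
Qed.

Lemma last_cols_complement js : all (leq 1) js ->
  [/\ Jsum js *m (Jsum js)^T + last_cols js *m (last_cols js)^T = 1%:M,
      (last_cols js)^T *m Jsum js = 0 & (last_cols js)^T *m last_cols js = 1%:M].
Proof.
elim: js => [_|r js IH] /=.
  by split; apply/matrixP=> - [] // ? ?; rewrite ?thinmx0 // => -[].
by case/andP=> /jordan_last h /IH; apply: (dsum_complement h).
Qed.

Lemma congruent_shift_Jsum k :
  congruent (block_mx 0 1%:M 0 0 : 'M[F]_(k + k)) (Jsum (nseq k 2)).
Proof.
elim: k => [|k IH]; first by apply: congruent_dim0.
apply: congruent_trans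
  (congruent_dsum (congruent_refl (jordan 2 0 : 'M_2)) IH).
pose h (x : ('I_1 + 'I_k) + ('I_1 + 'I_k)) :=
  match x with
  | inl (inl a) => inl (inl a) | inl (inr a) => inr (inl a)
  | inr (inl a) => inl (inr a) | inr (inr a) => inr (inr a)
  end : ('I_1 + 'I_1) + ('I_k + 'I_k).
pose h' (x : ('I_1 + 'I_1) + ('I_k + 'I_k)) :=
  match x with
  | inl (inl a) => inl (inl a) | inl (inr a) => inr (inl a)
  | inr (inl a) => inl (inr a) | inr (inr a) => inr (inr a)
  end : ('I_1 + 'I_k) + ('I_1 + 'I_k).
apply: (@congruent_reindex _ _ ((1 + k) + (1 + k)) ((1 + 1) + (k + k)) _ _
  (jsum (jsum id id) (jsum id id))
  (jsum (jsum id id) (jsum id id) \o h)).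
- by do !apply: jsum_bij; apply: id_bij.
- apply: bij_comp; first by do !apply: jsum_bij; apply: id_bij.
  by exists h'; [case=> [[x|x]|[x|x]] | case=> [[x|x]|[x|x]]].
- by case=> [[x|x]|[x|x]] [[y|y]|[y|y]] /=;
    rewrite /dsum ?(block_mxEul, block_mxEur, block_mxEdl, block_mxEdr) ?jordan0E
      ?mxE ?ord1 ?(eq_lshift, eq_rshift, eq_lrshift, eq_rlshift).
Qed.

Lemma ext_Jsum js : congruent (ext (Jsum js) (last_cols js))
  (Jsum [seq r.+2 | r <- js]).
Proof.
elim: js => [|r js IH] /=; first by apply: congruent_dim0.
apply: congruent_trans
  (ext_dsum (jordan r 0) (last_col r) (Jsum js) (last_cols js)) _.
by apply: congruent_dsum => //; apply: ext_jordan.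
Qed.

Lemma complete_rows l m (B : 'M[F]_(l, m)) : row_free B ->
  exists k (C : 'M_(k, m)), row_free (col_mx B C) /\ row_full (col_mx B C).
Proof.
move=> fB; exists _, (row_base (B^C)%MS).
have full : row_full (col_mx B (row_base (B^C)%MS)).
  have := addsmx_compl_full B; rewrite -!sub1mx => h; apply: submx_trans h _.
  by rewrite -addsmxE addsmxS // eq_row_base.
split=> //; move: full; rewrite -col_leq_rank -row_leq_rank; apply: leq_trans.
rewrite mxrank_compl; have := fB; rewrite /row_free => /eqP ->.
by rewrite subnKC // -(eqP fB) rank_leq_col.
Qed.

Lemma ext_regular n m (A : 'M[F]_n) (B : 'M[F]_(n, m)) r (R : 'M_r) js :
    R \in unitmx -> all (leq 1) js -> row_free (row_mx A B) ->
    congruent A (dsum R (Jsum js)) ->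
  exists2 js', all (leq 1) js' & congruent (ext A B) (dsum R (Jsum js')).
Proof.
move=> uR js1 freeAB [S [T [ST TS eA]]].
have [h1 h2 h3] := last_cols_complement js1.
pose Z := col_mx (0 : 'M_(r, size js)) (last_cols js).
pose X := dsum (invmx R) (Jsum js)^T.
set D := dsum R (Jsum js) in eA.
have DX : D *m X + Z *m Z^T = 1%:M.
  rewrite mul_dsum /Z tr_col_mx trmx0 mul_col_row !(mul0mx, mulmx0).
  by rewrite /dsum add_block_mx !addr0 h1 mulmxV // -scalar_mx_block.
have ZD : Z^T *m D = 0.
  by rewrite /Z tr_col_mx trmx0 mul_row_block !(mul0mx, mulmx0) h2 !addr0 row_mx0.
have ZZ : Z^T *m Z = 1%:M.
  by rewrite /Z tr_col_mx trmx0 mul_row_col mul0mx add0r h3.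
set B' := T *m B; set B0 := Z^T *m B'.
have eB' : B' = Z *m B0 + D *m (X *m B').
  by rewrite -[LHS]mul1mx -DX mulmxDl addrC /B0 !mulmxA.
have freeB0 : row_free B0.
  apply: inj_row_free => v vB0.
  have vZT : v *m Z^T *m T = 0.
    apply: (row_free_inj freeAB); rewrite mul0mx mul_mx_row eA !mulmxA.
    rewrite -(mulmxA (v *m _)) TS mulmx1 -(mulmxA v) ZD mulmx0 !mul0mx.
    rewrite -(mulmxA _ T B) -/B' -(mulmxA v) -/B0 vB0.
    by rewrite row_mx0.
  have : v *m Z^T *m T *m S *m Z = 0 by rewrite vZT !mul0mx.
  by rewrite -(mulmxA _ T S) TS mulmx1 -mulmxA ZZ mulmx1.
have [k [C [freeW fullW]]] := complete_rows freeB0.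
exists ([seq j.+2 | j <- js] ++ nseq k 2).
  by rewrite all_cat all_map all_nseq orbT andbT; apply/allP.
have c1 : congruent (ext A B) (ext D B').
  have {1}-> : B = S *m B' *m 1%:M by rewrite mulmx1 mulmxA ST mul1mx.
  by apply: (@ext_congr _ _ _ _ _ _ _ _ T _ 1%:M); rewrite ?mulmx1.
apply: congruent_trans c1 _.
have c2 : congruent (ext D B') (ext D (Z *m B0)).
  by rewrite {1}eB'; apply: ext_addmul.
apply: congruent_trans c2 _.
have c3 : congruent (ext D (Z *m B0)) (ext D (row_mx Z (0 : 'M_(_, k)))).
  have -> : Z *m B0 = 1%:M *m row_mx Z (0 : 'M_(_, k)) *m col_mx B0 C.
    by rewrite mul1mx mul_row_col mul0mx addr0.
  apply: (@ext_congr _ _ _ _ _ _ _ _ 1%:M _ (pinvmx (col_mx B0 C)));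
    by rewrite ?trmx1 ?mulmx1 ?mul1mx ?mulmxVp ?mulVpmx.
apply: congruent_trans c3 _.
apply: congruent_trans (ext_row0 _ _ _) _.
apply: congruent_trans
  (congruent_dsum (ext_dsuml _ _ _) (congruent_shift_Jsum _)) _.
apply: congruent_trans (congruent_sym (congruent_dsumA _ _ _)) _.
apply: congruent_dsum (congruent_refl _) _.
apply: (congruent_trans _ (congruent_sym (bdiag_cat _ _ _))).
exact: congruent_dsum (ext_Jsum _) (congruent_refl _).
Qed.

Theorem regularization n (A : 'M[F]_n) : exists r (R : 'M_r) js,
  [/\ R \in unitmx, all (leq 1) js & congruent A (dsum R (Jsum js))].
Proof.
elim/ltn_ind: n => n IH in A *.
have [uA|nuA] := boolP (A \in unitmx).
  by exists n, A, [::]; split=> //; apply: congruent_dsum0.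
have [[v [v0 vA vAT]]|norad] :
    (exists v : 'rV_n, [/\ v != 0, v *m A = 0 & v *m A^T = 0]) \/
    (forall v : 'rV_n, v *m A = 0 -> v *m A^T = 0 -> v = 0).
  have [r0|r0] := eqVneq (kermx A :&: kermx A^T)%MS 0; [right=> v vA vAT|left].
    by apply/eqP; rewrite -submx0 -r0 sub_capmx; apply/andP; split; apply/sub_kermxP.
  have [v] := rowV0Pn r0; rewrite sub_capmx => /andP[/sub_kermxP ? /sub_kermxP ?] ?.
  by exists v.
  have fv : row_free v by rewrite /row_free rank_rV v0.
  have [k [C [freeW fullW]]] := complete_rows fv.
  have c := congruent_free_full A freeW fullW.
  have kn : (k < n)%N.
    by move: freeW fullW; rewrite /row_free /row_full => /eqP -> /eqP <-.
  have [r [R [js [uR js1 c']]]] := IH k kn (C *m A *m C^T).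
  exists r, R, (1%N :: js); split=> //.
  apply: congruent_trans (congruent_sym c) _.
  have -> : col_mx v C *m A *m (col_mx v C)^T = dsum (jordan 1 0) (C *m A *m C^T).
    have Av : A *m v^T = 0 by apply: trmx_inj; rewrite trmx_mul trmxK vAT trmx0.
    rewrite tr_col_mx mul_col_mx mul_col_row vA !mul0mx -mulmxA Av mulmx0.
    congr block_mx; apply/matrixP=> i j; rewrite jordan0E mxE !ord1; case: eqP => //.
  apply: congruent_trans (congruent_dsum (congruent_refl _) c') _.
  apply: congruent_trans (congruent_dsumA _ _ _) _.
  apply: congruent_trans
    (congruent_dsum (congruent_dsumC _ _) (congruent_refl _)) _.
  exact: congruent_sym (congruent_dsumA _ _ _).
pose K := row_base (kermx A).
have KA : K *m A = 0 by apply/sub_kermxP; rewrite eq_row_base.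
have freeK : row_free K by apply: row_base_free.
have subK (v : 'rV_n) : v *m A = 0 -> (v <= K)%MS.
  by move=> /sub_kermxP; rewrite eq_row_base.
have AKT : A^T *m K^T = 0 by rewrite -trmx_mul KA trmx0.
move: (\rank _) K KA freeK subK AKT => m K KA freeK subK AKT.
have freeKA : row_free (K *m A^T).
  apply: inj_row_free => v; rewrite mulmxA => vK.
  apply: (row_free_inj freeK); rewrite mul0mx; apply: norad => //.
  by rewrite -mulmxA KA mulmx0.
have [W KW] := row_freeP freeKA.
have VK : W^T *m A *m K^T = 1%:M.
  by rewrite -(trmxK A) -!trmx_mul mulmxA KW trmx1.
set V := W^T in VK.
pose U := kermx (A *m K^T).
pose V1 := row_base (U :\: K)%MS.
have V1U : V1 *m A *m K^T = 0.
  by rewrite -mulmxA; apply/sub_kermxP; rewrite eq_row_base diffmxSl.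
have V1K : (V1 :&: K)%MS = 0.
  apply/eqP; rewrite -submx0 -(capmx_diff U K) capmxS // eq_row_base //.
have freeV1 : row_free V1 by apply: row_base_free.
have dimV1 : (\rank (U :\: K)%MS + (m + m) = n)%N.
  have rU : (\rank U + m = n)%N.
    rewrite mxrank_ker -mxrank_tr trmx_mul trmxK (eqP freeKA) subnK //.
    by rewrite -(eqP freeKA) rank_leq_col.
  have KU : (U :&: K :=: K)%MS.
    by apply/capmx_idPr; apply/sub_kermxP; rewrite mulmxA KA mul0mx.
  by have := mxrank_cap_compl U K; rewrite KU (eqP freeK); lia.
move: (\rank _) V1 V1U V1K freeV1 dimV1 => n1 V1 V1U V1K freeV1 dimV1.
pose S := col_mx V1 (col_mx V K).
have freeS : row_free S.
  apply: inj_row_free => x.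
  have [x1 [x2 [x3 ->]]] : exists x1 x2 x3, x = row_mx x1 (row_mx x2 x3).
    by exists (lsubmx x), (lsubmx (rsubmx x)), (rsubmx (rsubmx x)); rewrite !hsubmxK.
  rewrite !mul_row_col => x0.
  have x20 : x2 = 0.
    have := congr1 (fun y => y *m A *m K^T) x0.
    rewrite !mulmxDl !mul0mx -!mulmxA (mulmxA K) KA !(mulmxA _ A) V1U VK.
    by rewrite mul0mx !mulmx0 mulmx1 add0r addr0.
  move: x0; rewrite x20 mul0mx add0r => /eqP; rewrite addr_eq0 => /eqP x0.
  have : (x1 *m V1 <= V1 :&: K)%MS.
    by rewrite sub_capmx submxMl x0 -mulNmx submxMl.
  rewrite V1K submx0 => /eqP y0.
  have -> : x1 = 0 by apply: (row_free_inj freeV1); rewrite mul0mx.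
  have -> : x3 = 0.
    apply: (row_free_inj freeK); rewrite mul0mx; apply/eqP.
    by rewrite -oppr_eq0 -x0 y0.
  by rewrite !row_mx0.
have fullS : row_full S by rewrite /row_full (eqP freeS) dimV1.
pose A1 := V1 *m A *m V1^T; pose B := V1 *m A *m V^T.
have eS : S *m A *m S^T = block_mx A1 (row_mx B 0)
    (col_mx (V *m A *m V1^T) 0) (block_mx (V *m A *m V^T) 1%:M 0 0).
  rewrite /S !tr_col_mx mul_col_mx (mul_col_mx V) KA mul_col_row.
  rewrite (mul_mx_row (V1 *m A)) V1U (mul_col_mx (V *m A)) mul0mx.
  by rewrite mul_col_row !mul0mx VK.
have c := congruent_trans (congruent_sym (congruent_free_full A freeS fullS)).
have {}c : congruent A (ext A1 B).
  by apply: (c _ _ _); rewrite eS; apply: ext_clear.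
have freeAB : row_free (row_mx A1 B).
  apply: inj_row_free => v; rewrite mul_mx_row => /eqP.
  rewrite row_mx_eq0 => /andP[/eqP vA1 /eqP vB].
  have vS : v *m V1 *m A *m S^T = 0.
    have assoc p (Y : 'M_(n, p)) : v *m V1 *m A *m Y = v *m (V1 *m A *m Y).
      by rewrite !mulmxA.
    by rewrite /S !tr_col_mx !mul_mx_row !assoc vA1 vB V1U mulmx0 !row_mx0.
  have vV1A : v *m V1 *m A = 0.
    have := congr1 (fun y => y *m (pinvmx S)^T) vS.
    by rewrite -mulmxA -trmx_mul mulVpmx // trmx1 mulmx1 mul0mx.
  have : (v *m V1 <= V1 :&: K)%MS by rewrite sub_capmx submxMl subK.
  rewrite V1K submx0 => /eqP y0.
  by apply: (row_free_inj freeV1); rewrite mul0mx.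
have n1n : (n1 < n)%N.
  have m0 : (0 < m)%N; last by lia.
  rewrite lt0n; apply: contraNneq nuA => m0.
  rewrite -row_free_unit; apply: inj_row_free => v /subK.
  have -> : K = 0 by apply/matrixP=> i; have := ltn_ord i; lia.
  exact: submx0null.
have [r [R [js [uR js1 c']]]] := IH n1 n1n A1.
have [js' js1' c''] := ext_regular uR js1 freeAB c'.
by exists r, R, js'; split=> //; apply: congruent_trans c''.
Qed.

End Regularization.

(** * Cosquares *)

Section Cosquare.
Variable F : closedFieldType.
Hypothesis two_neq0 : 2%:R != 0 :> F.

(* One root at a time: replacing p by p + c q, with q the product so far, the
   condition at a new root a is a polynomial equation of degree 1 or 2 in c. *)
Lemma sqrt_X_modp (s : seq F) : all (fun a => a != 0) s ->
  exists p, \prod_(a <- s) ('X - a%:P) %| p ^+ 2 - 'X.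
Proof.
elim: s => [|a s IH] /=; first by exists 0; rewrite big_nil dvd1p.
case/andP=> a0 /IH[p]; set q := \prod_(_ <- s) _ => qp.
have [u eu] := dvdpP _ _ qp; rewrite mulrC in eu.
pose P := (u.[a])%:P + (2%:R * p.[a]) *: 'X + q.[a] *: 'X^2.
have [c rc] : exists c, root P c.
  apply/closed_rootP/negP => /size_poly1P [c c0 eP].
  have := congr1 (fun r : {poly F} => r`_1) eP.
  have := congr1 (fun r : {poly F} => r`_2) eP.
  rewrite !(coefD, coefZ, coefC, coefX, coefXn) /= !(mulr0, mulr1, addr0, add0r).
  move=> qa /eqP; rewrite mulf_eq0 (negPf two_neq0) /= => /eqP pa.
  have := congr1 (horner^~ a) eu; rewrite !hornerE pa qa mul0r expr0n /= sub0r.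
  by move/eqP; rewrite oppr_eq0 (negPf a0).
exists (p + c *: q).
have -> : (p + c *: q) ^+ 2 - 'X =
    q * (u + (2%:R * c) *: p + (c ^+ 2) *: q).
  rewrite mulrDr mulrDr -eu -!mul_polyC !polyCM polyC_natr; ring.
rewrite big_cons mulrC dvdp_mul // dvdp_XsubCl.
move: rc; rewrite /root !(hornerD, hornerZ, hornerC, hornerX, hornerXn).
by move=> /eqP <-; apply/eqP; ring.
Qed.

Lemma horner_mx_adjoint n (A X Y : 'M[F]_n.+1) p :
  X *m A = A *m Y^T -> horner_mx X p *m A = A *m (horner_mx Y p)^T.
Proof.
move=> h; elim/poly_ind: p => [|p c IH].
  by rewrite !rmorph0 mul0mx trmx0 mulmx0.
rewrite !rmorphD !rmorphM /= !horner_mx_X !horner_mx_C linearD /= tr_scalar_mx.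
rewrite mulmxDl mulmxDr scalar_mxC; congr (_ + _).
have XC : GRing.comm (horner_mx Y p) Y.
  by rewrite -{2}(horner_mx_X Y); apply: comm_horner_mx2.
by rewrite -mulmxE -mulmxA h mulmxA IH -mulmxA -trmx_mul mulmxE XC.
Qed.

Definition cosquare n (A : 'M[F]_n) := A *m invmx A^T.

Lemma cosquareP n (A L : 'M[F]_n) : A \in unitmx ->
  A = L *m A^T -> cosquare A = L.
Proof. by move=> uA e; rewrite /cosquare {1}e mulmxK // unitmx_tr. Qed.

Lemma cosquareK n (A : 'M[F]_n) : A \in unitmx -> cosquare A *m A^T = A.
Proof. by move=> uA; rewrite mulmxKV // unitmx_tr. Qed.

Lemma cosquare_unit n (A : 'M[F]_n) : A \in unitmx -> cosquare A \in unitmx.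
Proof. by move=> uA; rewrite unitmx_mul uA unitmx_inv unitmx_tr. Qed.

Lemma eq_cosquare_congruent n (A B : 'M[F]_n) : A \in unitmx -> B \in unitmx ->
  cosquare A = cosquare B -> congruent A B.
Proof.
case: n A B => [|n] A B uA uB e; first exact: congruent_dim0.
pose X := B *m invmx A.
have eB : B = X *m A by rewrite mulmxKV.
have XA : X *m A = A *m X^T.
  rewrite -eB -{1}(cosquareK uB) -e {1}eB trmx_mul.
  by rewrite mulmxA cosquareK.
have uX : X \in unitmx by rewrite unitmx_mul uB unitmx_inv.
have [r er] := closed_field_poly_normal (char_poly X).
move: er; rewrite (monicP (char_poly_monic X)) scale1r => er.
have r0 : all (fun a => a != 0) r.
  apply/allP=> a ar; apply/eqP=> a0.
  have : root (char_poly X) 0 by rewrite -a0 er root_prod_XsubC.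
  rewrite -eigenvalue_root_char => /eigenvalueP[v].
  rewrite scale0r => vX; apply/negP; rewrite negbK.
  by rewrite -(mulmxK uX v) vX mul0mx.
have [p] := sqrt_X_modp r0; rewrite -er => /dvdpP[q eqp2].
have YY : horner_mx X p *m horner_mx X p = X.
  apply/eqP; rewrite -subr_eq0 -{3}(horner_mx_X X).
  rewrite mulmxE -expr2 -rmorphXn -rmorphB /= eqp2 rmorphM /=.
  by rewrite Cayley_Hamilton mulr0.
move: (horner_mx X p) YY (horner_mx_adjoint p XA) => Y YY YA.
have uY : Y \in unitmx by move: uX; rewrite -YY unitmx_mul => /andP[].
apply: congruent_sym; exists Y, (invmx Y).
by rewrite mulmxV // mulVmx // -mulmxA -YA mulmxA YY.
Qed.

Lemma similar_cosquare_congruent m n (A : 'M[F]_m) (B : 'M[F]_n) :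
  A \in unitmx -> B \in unitmx ->
  similar_mx (cosquare A) (cosquare B) -> congruent A B.
Proof.
move=> uA uB [S [T [ST TS e]]].
have mn := mulmx1_eq_dim ST TS; subst n.
have [uS uT] := mulmx1_unit ST.
have c : congruent (S *m B *m S^T) B by exists S, T.
apply: congruent_trans c; apply: eq_cosquare_congruent => //.
  by rewrite !unitmx_mul uS uB unitmx_tr.
rewrite e; symmetry; apply: cosquareP.
  by rewrite !unitmx_mul uS uB unitmx_tr.
by rewrite !trmx_mul trmxK -{1}(cosquareK uB) !mulmxA -(mulmxA _ T) TS mulmx1.
Qed.

End Cosquare.

(** * Jordan blocks and the cosquares of H and Gamma *)

Section JordanBlocks.
Variable F : fieldType.

Lemma jordanE n (a : F) : jordan n a = jordan n 0 + a%:M.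
Proof.
apply/matrixP=> i j; rewrite !mxE -val_eqE /=.
by case: ifP => _; rewrite ?add0r ?addr0.
Qed.

Lemma mul_row_jordan0 n (v : 'rV[F]_n) (i j : 'I_n) :
  i.+1 = j -> (v *m jordan n 0) 0 j = v 0 i.
Proof.
move=> ij; rewrite mxE (bigD1 i) //= jordan0E ij eqxx mulr1 big1 ?addr0 //.
move=> l li; rewrite jordan0E -ij eqSS val_eqE (negPf li); exact: mulr0.
Qed.

Lemma mul_row_jordan0_0 n (v : 'rV[F]_n) (j : 'I_n) :
  j = 0%N :> nat -> (v *m jordan n 0) 0 j = 0.
Proof.
by move=> j0; rewrite mxE big1 // => l _; rewrite jordan0E j0 mulr0.
Qed.

Lemma jordan_left_eigen n (a b : F) (v : 'rV_n.+1) :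
  v *m jordan n.+1 a = b *: v -> v != 0 ->
  b = a /\ v = v 0 ord_max *: delta_mx 0 ord_max.
Proof.
rewrite jordanE mulmxDr mul_mx_scalar => /eqP; rewrite eq_sym -subr_eq -scalerBl.
move=> /eqP e v0.
have ba : b = a.
  apply/eqP; rewrite -subr_eq0; apply: contraNT v0 => c0.
  apply/eqP/rowP=> j; rewrite mxE; case: j => j hj.
  elim: j hj => [|j IH] hj; have /rowP/(_ (Ordinal hj)) := e; rewrite mxE.
    rewrite mul_row_jordan0_0 // => /eqP.
    by rewrite mulf_eq0 (negPf c0) => /eqP.
  rewrite (@mul_row_jordan0 _ _ (Ordinal (ltnW hj))) // IH => /eqP.
  by rewrite mulf_eq0 (negPf c0) => /eqP.
split=> //; apply/rowP=> j; rewrite !mxE eqxx /=.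
have [->|jn] := eqVneq j ord_max; first by rewrite mulr1.
have lt : (j.+1 < n.+1)%N by rewrite ltnS ltn_neqAle -ltnS ltn_ord andbT; exact: jn.
rewrite mulr0 -(@mul_row_jordan0 _ _ _ (Ordinal lt)) // -e ba subrr scale0r.
by rewrite mxE.
Qed.

Lemma jordan0_exp n k (i j : 'I_n) :
  (jordan n (0 : F) ^+ k) i j = (i + k == j)%N%:R.
Proof.
elim: k i j => [|k IH] i j; first by rewrite addn0 expr0 mxE -val_eqE.
rewrite exprSr mxE; under eq_bigr => l _ do rewrite IH jordan0E.
have [lt|ge] := ltnP (i + k) n.
  rewrite (bigD1 (Ordinal lt)) //= eqxx mul1r addnS big1 ?addr0 // => l.
  by rewrite -val_eqE eq_sym => /negPf /= ->; rewrite mul0r.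
rewrite big1 => [|l _]; last by rewrite gtn_eqF ?mul0r // (leq_trans (ltn_ord _)).
by rewrite gtn_eqF // addnS ltnS (leq_trans (ltnW (ltn_ord _))).
Qed.

Lemma jordan_unit n (a : F) : a != 0 -> jordan n a \in unitmx.
Proof.
move=> a0; rewrite unitmxE -det_tr det_trig.
  rewrite rpred_prod // => i _; rewrite !mxE eqxx unitfE //.
apply/is_trig_mxP=> i j ij; rewrite !mxE gtn_eqF // gtn_eqF //.
by rewrite (ltn_trans ij).
Qed.

End JordanBlocks.

Section Jordan.
Variable F : closedFieldType.

Lemma stable_kernel_eigenvector n (G L : 'M[F]_n) : G \notin unitmx ->
    (forall v : 'rV_n, v *m G = 0 -> v *m L *m G = 0) ->
  exists a (v : 'rV_n), [/\ v != 0, v *m G = 0 & v *m L = a *: v].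
Proof.
move=> nuG st.
pose K := row_base (kermx G).
have KG : K *m G = 0 by apply/sub_kermxP; rewrite eq_row_base.
have freeK : row_free K by apply: row_base_free.
have KL : (K *m L <= K)%MS.
  apply/row_subP=> i; rewrite eq_row_base row_mul; apply/sub_kermxP/st.
  by rewrite -row_mul KG row0.
have m0 : (0 < \rank (kermx G))%N.
  by rewrite lt0n mxrank_eq0 kermx_eq0 row_free_unit.
have [M eM] := submxP KL.
move: (\rank _) K KG freeK KL m0 M eM => m K KG freeK KL m0 M eM.
have /closed_rootP[a ra] : size (char_poly M) != 1%N.
  by rewrite size_char_poly; case: (m) m0.
move: ra; rewrite -eigenvalue_root_char => /eigenvalueP[w wM w0].
exists a, (w *m K); split.
- apply: contraNneq w0 => wK; apply/eqP; apply: (row_free_inj freeK).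
  by rewrite wK mul0mx.
- by rewrite -mulmxA KG mulmx0.
- by rewrite -mulmxA eM mulmxA wM scalemxAl.
Qed.

Definition cyclic_rows n k (N : 'M[F]_n) (x : 'rV[F]_n) : 'M[F]_(k, n) :=
  \matrix_(i < k) (x *m N ^+ i).

Lemma cyclic_rows_jordan n k (N : 'M[F]_n) (x : 'rV_n) a :
  x *m N ^+ k = 0 ->
  cyclic_rows k N x *m (N + a%:M) = jordan k a *m cyclic_rows k N x.
Proof.
move=> xN; rewrite jordanE mulmxDl mulmxDr scalar_mxC; congr (_ + _).
apply/row_matrixP=> i; rewrite !row_mul rowK -mulmxA -[_ *m N]exprSr.
apply/rowP=> l; rewrite [RHS]mxE.
under eq_bigr => j _ do rewrite [row i _ _ _]mxE jordan0E.
have [lt|ge] := ltnP i.+1 k.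
  rewrite (bigD1 (Ordinal lt)) //= eqxx mul1r big1 ?addr0.
    by rewrite [cyclic_rows _ _ _ _ _]mxE.
  by move=> j; rewrite -val_eqE eq_sym /= => /negPf ->; rewrite mul0r.
have e : i.+1 = k by apply/eqP; rewrite eqn_leq ge ltn_ord.
rewrite e xN mxE big1 // => j _.
by rewrite gtn_eqF ?mul0r // (leq_trans (ltn_ord j)).
Qed.

Lemma delta_cyclic_rows n k (N : 'M[F]_n) (x : 'rV_n) (i : 'I_k) :
  delta_mx 0 i *m cyclic_rows k N x = x *m N ^+ i.
Proof. by rewrite -rowE rowK. Qed.

Lemma nilpotent_similar_jordan n (M : 'M[F]_n.+1) (a : F) :
  (M - a%:M) ^+ n.+1 = 0 -> (M - a%:M) ^+ n != 0 ->
  similar_mx M (jordan n.+1 a).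
Proof.
set N := M - _ => N0 Nn0.
have MN : M = N + a%:M by rewrite subrK.
have [i xi0] : exists i, row i (N ^+ n) != 0.
  have [z|] := pickP (fun i => row i (N ^+ n) != 0); first by exists z.
  move=> h; case/eqP: Nn0; apply/row_matrixP=> i; rewrite row0.
  by apply/eqP/negPn; rewrite h.
pose P := cyclic_rows n.+1 N (delta_mx 0 i).
have PM : P *m M = jordan n.+1 a *m P.
  by rewrite MN; apply: cyclic_rows_jordan; rewrite N0 mulmx0.
have uP : P \in unitmx.
  apply/negPn/negP=> nuP.
  have [v vP|b [v [v0 vP vL]]] := stable_kernel_eigenvector (L := jordan n.+1 a) nuP.
    by rewrite -mulmxA -PM mulmxA vP mul0mx.
  have [_ ev] := jordan_left_eigen vL v0.
  move: vP; rewrite ev -scalemxAl delta_cyclic_rows -rowE => /eqP.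
  rewrite scaler_eq0 (negPf xi0) orbF => /eqP c0.
  by move: v0; rewrite ev c0 scale0r eqxx.
exists (invmx P), P; rewrite mulmxV // mulVmx //; split=> //.
by rewrite -mulmxA -PM mulKmx.
Qed.

Lemma jordan0_nilpotent n : jordan n (0 : F) ^+ n = 0.
Proof.
apply/matrixP=> i j; rewrite jordan0_exp mxE gtn_eqF //.
by rewrite (leq_trans (ltn_ord j)) ?leq_addl.
Qed.

Lemma jordan0_exp_neq0 n : jordan n.+1 (0 : F) ^+ n != 0.
Proof.
apply/eqP=> /matrixP/(_ 0 ord_max); rewrite jordan0_exp mxE add0n eqxx.
by move/eqP; rewrite oner_eq0.
Qed.

Lemma trmx_exp n (A : 'M[F]_n) k : (A ^+ k)^T = A^T ^+ k.
Proof.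
elim: k => [|k IH]; first by rewrite !expr0 trmx1.
by rewrite exprS exprSr [_ * _]/(_ *m _) trmx_mul IH.
Qed.

Lemma jordan_tr_inv_similar n (a : F) : a != 0 ->
  similar_mx (invmx (jordan n.+1 a)^T) (jordan n.+1 a^-1).
Proof.
move=> a0; set J := jordan _ a; have uJ : J^T \in unitmx.
  by rewrite unitmx_tr jordan_unit.
have eN : invmx J^T - a^-1%:M = (- a^-1) *: (invmx J^T *m (jordan n.+1 0)^T).
  have -> : (jordan n.+1 0)^T = J^T - a%:M.
    by rewrite /J (jordanE _ a) linearD /= tr_scalar_mx addrK.
  rewrite mulmxBr mulVmx // mul_mx_scalar scalerBr scalerA mulNr mulVf //.
  by rewrite scaleN1r opprK addrC scalemx1 raddfN.
have cJ : GRing.comm (invmx J^T) (jordan n.+1 0)^T.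
  apply: commr_sym; apply: commrV; rewrite /J (jordanE _ a) linearD /= tr_scalar_mx.
  by apply: commrD; [exact: commr_refl | exact: comm_mx_scalar].
apply: nilpotent_similar_jordan; rewrite eN exprZn [_ *m _]/(_ * _).
  by rewrite exprMn_comm // -[(jordan _ _)^T ^+ _]trmx_exp jordan0_nilpotent trmx0
    mulr0 scaler0.
rewrite exprMn_comm // -[(jordan _ _)^T ^+ _]trmx_exp scaler_eq0 negb_or.
rewrite expf_neq0 ?oppr_eq0 ?invr_eq0 //=.
have u : (invmx J^T : 'M_n.+1) ^+ n \is a GRing.unit.
  by rewrite unitrX // [_ \is a _]unitmx_inv.
apply: contraNneq (jordan0_exp_neq0 n) => e; apply/eqP.
by apply: trmx_inj; apply: (mulrI u); rewrite trmx0 mulr0.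
Qed.

Lemma Hmx_cosquare m (a : F) : a != 0 -> Hmx m a \in unitmx /\
  cosquare (Hmx m a) = dsum (invmx (jordan m a)^T) (jordan m a).
Proof.
move=> a0; have uJ := jordan_unit m a0.
have uH : Hmx m a \in unitmx.
  have -> : Hmx m a = dsum 1%:M (jordan m a) *m block_mx 0 1%:M 1%:M 0.
    by rewrite mulmx_block !(mulmx0, mul0mx, addr0, add0r) mul1mx mulmx1.
  rewrite unitmx_mul dsum_unit unitmx1 uJ /=.
  suff /mulmx1_unit[] : block_mx 0 1%:M 1%:M 0 *m block_mx 0 1%:M 1%:M 0
    = 1%:M :> 'M[F]_(m + m) by [].
  rewrite mulmx_block !(mulmx0, mul0mx, addr0, add0r) mul1mx.
  by rewrite -scalar_mx_block.
split=> //; apply: cosquareP => //.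
rewrite /Hmx tr_block_mx !trmx0 trmx1 mulmx_block.
by rewrite !(mulmx0, mul0mx, addr0, add0r) mulmx1 mulVmx // unitmx_tr.
Qed.

Lemma mxrank_exp n (A : 'M[F]_n) k : (n.-1 <= \rank A)%N ->
  (n - k <= \rank (A ^+ k))%N.
Proof.
move=> rA; elim: k => [|k IH]; first by rewrite expr0 mxrank1 subn0.
rewrite exprSr -[A ^+ k * A]/(A ^+ k *m A).
move: (mxrank_mul_min (A ^+ k) A) IH rA.
move: (\rank (A ^+ k *m A)) (\rank (A ^+ k)) (\rank A) => a b c; lia.
Qed.

End Jordan.

Lemma char_poly_strict_trig (R : idomainType) n (N T D : 'M[R]_n) :
    N *m T = D -> is_trig_mx T -> \det T != 0 ->
    (forall i j : 'I_n, (i <= j)%N -> D i j = 0) ->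
  char_poly N = 'X^n.
Proof.
move=> eN trT T0 D0.
suff : char_poly N * (\det T)%:P = 'X^n * (\det T)%:P.
  by apply: mulIf; rewrite polyC_eq0.
rewrite /char_poly -det_map_mx -det_mulmx /char_poly_mx mulmxBl -map_mxM.
rewrite eN mul_scalar_mx det_trig.
  rewrite det_map_mx (det_trig trT) rmorph_prod /= -[in 'X^_](card_ord n).
  rewrite -prodr_const -big_split /=; apply: eq_bigr => i _.
  by rewrite !mxE D0 // subr0.
apply/is_trig_mxP=> i j ij; rewrite !mxE D0 1?ltnW //.
by move/is_trig_mxP: trT => ->; rewrite ?mulr0 ?subr0.
Qed.

Section Gamma.
Variable F : closedFieldType.
Hypothesis two_neq0 : 2%:R != 0 :> F.
Variable n : nat.
Local Notation G := (Gamma F n.+1).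
Local Notation mu := ((-1) ^+ n : F).
Local Notation P := (\matrix_(i, j) (i == rev_ord j)%:R : 'M[F]_n.+1).

Lemma mulmx_rev (A : 'M[F]_n.+1) i j : (A *m P) i j = A i (rev_ord j).
Proof.
rewrite mxE (bigD1 (rev_ord j)) //= mxE eqxx mulr1 big1 ?addr0 // => k kj.
by rewrite mxE (negPf kj) mulr0.
Qed.

Lemma GammaE (i j : 'I_n.+1) : G i j =
  if (i + j == n)%N || (i + j == n.+1)%N then (-1) ^+ (n - i) else 0.
Proof.
rewrite mxE /= subSS; congr (if _ then _ else _); have := ltn_ord i.
by move=> ?; congr (_ || _); apply/eqP/eqP; lia.
Qed.

(* Reversing the columns makes both Gamma and its transpose triangular. *)
Lemma Gamma_tr_rev i j : (G^T *m P) i j =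
  if (i == j :> nat) || (i == j.+1 :> nat) then (-1) ^+ j else 0.
Proof.
rewrite mulmx_rev mxE GammaE /= subSS subKn; last by have := ltn_ord j; lia.
by congr (if _ then _ else _); congr (_ || _); apply/eqP/eqP;
  have := ltn_ord i; have := ltn_ord j; lia.
Qed.

Lemma Gamma_diff_rev i j : ((G - mu *: G^T) *m P) i j =
  if (i == j.+1 :> nat) then - 2%:R * (-1) ^+ (n + j) else 0.
Proof.
have -> : ((G - mu *: G^T) *m P) i j = G i (rev_ord j) - mu * (G^T *m P) i j.
  by rewrite !mulmx_rev !mxE.
rewrite Gamma_tr_rev GammaE /= subSS.
have ij : (i + (n - j) == n.+1)%N = (i == j.+1 :> nat).
  by apply/eqP/eqP; have := ltn_ord i; have := ltn_ord j; lia.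
have ij' : (i + (n - j) == n)%N = (i == j :> nat).
  by apply/eqP/eqP; have := ltn_ord i; have := ltn_ord j; lia.
rewrite ij ij'.
have sgn a b : odd a = odd b -> (-1) ^+ a = (-1) ^+ b :> F.
  by move=> e; rewrite -signr_odd e signr_odd.
have [e|ne] := eqVneq (i : nat) j.
  rewrite e /= ltn_eqF // -exprD (sgn _ (n + j)%N) ?subrr //.
  by rewrite oddB ?oddD // -ltnS.
case: eqP => [e|_] /=; last by rewrite mulr0 subrr.
have jn : (j < n)%N by have := ltn_ord i; lia.
rewrite -exprD (sgn (n - i)%N (n + j).+1); first by rewrite exprS; ring.
by rewrite e oddB // oddS oddS oddD; case: (odd n); case: (odd j).
Qed.

Lemma Gamma_tr_rev_trig : is_trig_mx (G^T *m P).
Proof.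
apply/is_trig_mxP=> i j ij; rewrite Gamma_tr_rev.
by rewrite ltn_eqF // ltn_eqF // ltnW.
Qed.

Lemma det_Gamma_tr_rev : \det (G^T *m P) != 0.
Proof.
rewrite (det_trig Gamma_tr_rev_trig); apply/prodf_neq0=> i _.
by rewrite Gamma_tr_rev eqxx /= signr_eq0.
Qed.

Lemma Gamma_unit : G \in unitmx.
Proof.
by rewrite -unitmx_tr unitmxE unitfE; apply: contraNneq det_Gamma_tr_rev;
  rewrite det_mulmx => ->; rewrite mul0r.
Qed.

Lemma Gamma_cosquare : similar_mx (cosquare G) (jordan n.+1 mu).
Proof.
have uG := Gamma_unit; have uGT : G^T \in unitmx by rewrite unitmx_tr.
set N := cosquare G - mu%:M.
have eN : N *m (G^T *m P) = (G - mu *: G^T) *m P.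
  by rewrite mulmxA /N mulmxBl cosquareK // mul_scalar_mx.
have uT : G^T *m P \in unitmx by rewrite unitmxE unitfE det_Gamma_tr_rev.
have rD : (n <= \rank N)%N.
  rewrite -(mxrankMfree N (_ : row_free (G^T *m P))) ?row_free_unit // eN.
  have : (\rank (kermx ((G - mu *: G^T) *m P)) <= 1)%N.
    apply: (leq_trans (mxrankS _) (rank_leq_row (delta_mx 0 0 : 'rV[F]_n.+1))).
    apply/row_subP=> i.
    have := row_sub i (kermx ((G - mu *: G^T) *m P)).
    move: (row i _) => v /sub_kermxP vD; apply/submxP.
    exists (v 0 0)%:M; rewrite mul_scalar_mx.
    apply/rowP=> j; rewrite !mxE /=; have [->|j0] := eqVneq j 0; first by rewrite mulr1.
    rewrite mulr0.
    have lt : (j.-1 < n.+1)%N by have := ltn_ord j; lia.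
    have /rowP/(_ (Ordinal lt)) := vD; rewrite mxE (bigD1 j) //= big1 => [|k kj].
      rewrite Gamma_diff_rev /= prednK ?lt0n // eqxx addr0 mxE => /eqP.
      rewrite mulf_eq0 mulf_eq0 oppr_eq0 (negPf two_neq0) signr_eq0 !orbF.
      by move/eqP.
    rewrite Gamma_diff_rev /= prednK ?lt0n // ifN ?mulr0 //.
  rewrite mxrank_ker; lia.
apply: nilpotent_similar_jordan; rewrite -/N.
  have := Cayley_Hamilton N.
  suff -> : char_poly N = 'X^(n.+1) by rewrite rmorphXn /= horner_mx_X.
  apply: char_poly_strict_trig eN Gamma_tr_rev_trig det_Gamma_tr_rev _ => i j ij.
  by rewrite Gamma_diff_rev ltn_eqF // ltnS.
have := mxrank_exp n rD; rewrite subSnn => rN.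
by apply: contraTneq rN => ->; rewrite mxrank0.
Qed.

End Gamma.

(** * Canonical form of invertible matrices *)

Section Regular.
Variable F : closedFieldType.
Hypothesis two_neq0 : 2%:R != 0 :> F.

Lemma congruent_split n k (A : 'M[F]_n) (X : 'M_(k, n)) (L : 'M_k) :
    A \in unitmx -> X *m cosquare A = L *m X -> X *m A *m X^T \in unitmx ->
  exists m (A' : 'M_m), congruent A (dsum (X *m A *m X^T) A').
Proof.
move=> uA XL uG.
have XA : X *m A = L *m (X *m A^T) by rewrite -{1}(cosquareK uA) mulmxA XL -mulmxA.
pose Y := row_base (kermx (A *m X^T)).
have YX : Y *m A *m X^T = 0.
  by rewrite -mulmxA; apply/sub_kermxP; rewrite eq_row_base.
have XY : X *m A *m Y^T = 0.
  rewrite XA -mulmxA (_ : _ *m Y^T = (Y *m A *m X^T)^T).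
    by rewrite YX trmx0 mulmx0.
  by rewrite !trmx_mul trmxK mulmxA.
have freeY : row_free Y by apply: row_base_free.
have dimY : (k + \rank (kermx (A *m X^T)) = n)%N.
  rewrite mxrank_ker -mxrank_tr trmx_mul trmxK.
  have /eqP rX : row_free (X *m A^T).
    apply: inj_row_free => v; rewrite mulmxA => vX.
    have : v *m X = 0.
      have uAT : A^T \in unitmx by rewrite unitmx_tr.
      by rewrite -(mulmxK uAT (v *m X)) vX mul0mx.
    by move=> {}vX; rewrite -(mulmxK uG v) !mulmxA vX !mul0mx.
  by rewrite rX subnKC // -rX rank_leq_col.
move: (\rank _) Y YX XY freeY dimY => m Y YX XY freeY dimY.
have freeS : row_free (col_mx X Y).
  apply: inj_row_free => v; rewrite -[v]hsubmxK mul_row_col.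
  move: (lsubmx v) (rsubmx v) => a b ab.
  have a0 : a = 0.
    rewrite -(mulmxK uG a) !mulmxA.
    have -> : a *m X *m A *m X^T = (a *m X + b *m Y) *m A *m X^T.
      by rewrite !mulmxDl -!mulmxA (mulmxA Y) YX mulmx0 addr0.
    by rewrite ab !mul0mx.
  move: ab; rewrite a0 mul0mx add0r => bY.
  by rewrite (_ : b = 0) ?row_mx0 //; apply: (row_free_inj freeY); rewrite mul0mx.
have fullS : row_full (col_mx X Y) by rewrite /row_full (eqP freeS) dimY.
exists m, (Y *m A *m Y^T).
apply: (congruent_trans (congruent_sym (congruent_free_full A freeS fullS))).
by rewrite tr_col_mx mul_col_mx mul_col_row XY YX; apply: congruent_refl.
Qed.

Lemma cosquare_gram n k (A : 'M[F]_n) (X : 'M_(k, n)) (L : 'M_k) :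
    A \in unitmx -> X *m cosquare A = L *m X -> X *m A *m X^T \in unitmx ->
  cosquare (X *m A *m X^T) = L.
Proof.
move=> uA XL uG; apply: cosquareP => //.
by rewrite !trmx_mul trmxK -{1}(cosquareK uA) (mulmxA X (cosquare A)) XL !mulmxA.
Qed.

Lemma gram_unit n k (A : 'M[F]_n) (X : 'M_(k, n)) (L : 'M_k) :
    A \in unitmx -> L \in unitmx -> X *m cosquare A = L *m X ->
    (forall a (v : 'rV_k), v != 0 -> v *m L = a *: v ->
       v *m (X *m A *m X^T) != 0) ->
  X *m A *m X^T \in unitmx.
Proof.
move=> uA uL XL h; set G := X *m A *m X^T.
have eG : G = L *m G *m L^T.
  have e : G = L *m G^T.
    by rewrite /G !trmx_mul trmxK -{1}(cosquareK uA) (mulmxA X (cosquare A)) XL !mulmxA.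
  by rewrite {1}e {1}e trmx_mul trmxK mulmxA.
apply/negPn/negP => nuG.
have [v vG|a [v [v0 vG vL]]] := stable_kernel_eigenvector (L := L) nuG.
  have uLT : L^T \in unitmx by rewrite unitmx_tr.
  have e : v *m L *m G *m L^T = 0 by rewrite -(mulmxA v L) -(mulmxA v) -eG.
  by rewrite -(mulmxK uLT (_ *m G)) e mul0mx.
by have := h a v v0 vL; rewrite -/G vG eqxx.
Qed.

Section Pair.
Variables (n : nat) (A : 'M[F]_n.+1).
Hypothesis uA : A \in unitmx.
Let Phi := cosquare A.
Let uPhi : Phi \is a GRing.unit := cosquare_unit uA.

Let Psi := Phi^-1.

Lemma invPhi_mul : Psi *m A = A^T.
Proof. by rewrite -{1}(cosquareK uA) mulmxA [Psi *m Phi]mulVr // mul1mx. Qed.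

Lemma mul_trPhi : A *m Phi^T = A^T.
Proof.
by rewrite /Phi /cosquare trmx_mul trmx_inv trmxK mulmxA mulmxV // mul1mx.
Qed.

Lemma mul_trPsi : A *m Psi^T = Phi *m A.
Proof.
have uPT : Phi^T \in unitmx by rewrite unitmx_tr.
rewrite [Psi]/(invmx Phi) trmx_inv; apply: (can_inj (mulmxK uPT)).
by rewrite mulmxKV // -mulmxA mul_trPhi cosquareK.
Qed.

Lemma Phi_adj p : horner_mx Phi p *m A = A *m (horner_mx Psi p)^T.
Proof. by apply: horner_mx_adjoint; rewrite mul_trPsi. Qed.

Lemma Psi_adj p : horner_mx Psi p *m A = A *m (horner_mx Phi p)^T.
Proof. by apply: horner_mx_adjoint; rewrite invPhi_mul mul_trPhi. Qed.

Lemma horner_XsubC_exp (B : 'M[F]_n.+1) a k :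
  horner_mx B (('X - a%:P) ^+ k) = (B - a%:M) ^+ k.
Proof. by rewrite rmorphXn rmorphB /= horner_mx_X horner_mx_C. Qed.

Lemma Psi_shift mu : mu != 0 ->
  Psi - mu%:M = (- mu) *: (Psi * (Phi - mu^-1%:M)).
Proof.
move=> mu0; rewrite mulrBr mulVr // -[Psi * _]/(Psi *m _) mul_mx_scalar.
rewrite scalerBr scalerA mulNr mulfV // scaleN1r opprK addrC.
by rewrite scaleNr scalemx1.
Qed.

Lemma Psi_Phi_comm a : GRing.comm Psi (Phi - a%:M).
Proof.
apply: commr_sym; apply: commrV; apply: commr_sym; apply: commrB => //.
exact: comm_mx_scalar.
Qed.

Lemma Psi_shift_exp mu k : mu != 0 ->
  (Psi - mu%:M) ^+ k = (- mu) ^+ k *: ((Phi - mu^-1%:M) ^+ k * Psi ^+ k).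
Proof.
move=> mu0; have c := Psi_Phi_comm mu^-1.
rewrite Psi_shift // exprZn exprMn_comm //; congr (_ *: _).
by apply: commrX; apply: commr_sym; apply: commrX; apply: commr_sym.
Qed.

Lemma jordan_pair : exists k mu (x y : 'rV[F]_n.+1),
  [/\ mu != 0, x *m (Phi - mu%:M) ^+ k.+1 = 0, y *m (Phi - mu^-1%:M) ^+ k.+1 = 0
    & x *m (Phi - mu%:M) ^+ k *m A *m y^T != 0].
Proof.
pose p := mxminpoly Phi.
have pPhi : horner_mx Phi p = 0 := mx_root_minpoly Phi.
have p0 : p != 0 by rewrite monic_neq0 // mxminpoly_monic.
have /closed_rootP[mu rmu] : size p != 1%N.
  by rewrite size_mxminpoly eqSS -lt0n mxminpoly_nonconstant.
have mu0 : mu != 0.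
  apply/eqP=> mu0; move: rmu; rewrite root_mxminpoly -eigenvalue_root_char mu0.
  case/eigenvalueP=> v; rewrite scale0r => vP; apply/negP; rewrite negbK.
  by rewrite -(mulmxK uPhi v) vP mul0mx.
have [[|k] [q]] := multiplicity_XsubC p mu; rewrite p0 /= => rq ep.
  by move: rmu; rewrite ep expr0 mulr1 (negPf rq).
exists k, mu.
pose N := Phi - mu%:M.
have hN j : horner_mx Phi (('X - mu%:P) ^+ j) = N ^+ j by apply: horner_XsubC_exp.
have q0 : q != 0 by apply: contraNneq p0 => q0; rewrite ep q0 mul0r.
have M0 : N ^+ k *m horner_mx Phi q *m A != 0.
  apply/eqP=> e; have /mxminpoly_min : horner_mx Phi (('X - mu%:P) ^+ k * q) = 0.
    by rewrite rmorphM /= hN -[LHS](mulmxK uA) e mul0mx.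
  rewrite -/p => /dvdp_leq; rewrite mulf_eq0 negb_or q0 expf_neq0 ?polyXsubC_eq0 //.
  rewrite ep exprSr mulrA [q * _]mulrC size_Mmonic ?monicXsubC //.
    by rewrite size_XsubC addn2 /= => /(_ isT); rewrite ltnn.
  by rewrite mulf_neq0 // expf_neq0 // polyXsubC_eq0.
have /matrix0Pn[i [j Mij]] := M0.
have cop : coprimep q (('X - mu%:P) ^+ k.+1).
  by rewrite coprimep_expr // coprimep_XsubC.
have [[u v] /= uv] := Bezout_eq1_coprimepP _ _ cop.
pose x := delta_mx 0 i *m horner_mx Phi q : 'rV[F]_n.+1.
pose y0 := delta_mx 0 j : 'rV[F]_n.+1.
pose y := y0 *m horner_mx Psi (u * q).
have xN : x *m N ^+ k.+1 = 0.
  rewrite -mulmxA -hN mulmxE -rmorphM -ep.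
  by rewrite /= pPhi mulmx0.
have comm_qN l : horner_mx Phi q *m N ^+ l = N ^+ l *m horner_mx Phi q.
  by rewrite -hN; apply: comm_horner_mx2.
exists x, y; split=> //.
  have pPsi : horner_mx Psi p = 0.
    apply: trmx_inj; apply: (can_inj (mulKmx uA)).
    by rewrite -Phi_adj pPhi trmx0 mul0mx mulmx0.
  have : y *m (Psi - mu%:M) ^+ k.+1 = 0.
    rewrite -horner_XsubC_exp -mulmxA mulmxE -rmorphM -mulrA -ep rmorphM /= pPsi.
    by rewrite mulr0 mulmx0.
  rewrite Psi_shift_exp // -scalemxAr => /eqP.
  rewrite scaler_eq0 expf_eq0 oppr_eq0 (negPf mu0) andbF /= mulmxA => /eqP yN.
  have uX : Psi ^+ k.+1 \is a GRing.unit by rewrite unitrX // unitrV.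
  by rewrite -(mulmxK uX (y *m _)) yN mul0mx.
have -> : x *m N ^+ k *m A *m y^T = x *m N ^+ k *m A *m y0^T.
  rewrite /y trmx_mul !mulmxA -(mulmxA _ A) -Phi_adj !mulmxA; congr (_ *m _ *m _).
  have -> : u * q = 1 - v * ('X - mu%:P) ^+ k.+1 by rewrite -uv addrK.
  rewrite rmorphB rmorph1 /= mulmxBr mulmx1 [v * _]mulrC rmorphM /= hN.
  have z : x *m N ^+ k *m N ^+ k.+1 = 0.
    by rewrite -mulmxA mulmxE -exprD addnC exprD -mulmxE mulmxA xN mul0mx.
  by rewrite -mulmxE mulmxA z mul0mx subr0.
apply: contraNneq Mij => e; apply/eqP.
transitivity ((x *m N ^+ k *m A *m y0^T) 0 0); last by rewrite e mxE.
rewrite /x /y0 trmx_delta -colE -(mulmxA _ _ (N ^+ k)) comm_qN.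
by rewrite -rowE -row_mul [RHS]mxE [RHS]mxE.
Qed.

(* With b(x, y) = x A y^T one has b(x, y) = b(y Phi^-1, x), and Phi - mu is
   adjoint to Phi^-1 - mu, a multiple of Phi^-1 (Phi - mu^-1). *)
Lemma pairing_sym k mu (x y : 'rV[F]_n.+1) : mu != 0 ->
  y *m (Phi - mu^-1%:M) ^+ k.+1 = 0 ->
  x *m (Phi - mu%:M) ^+ k *m A *m y^T =
  ((- mu) ^+ k * mu ^+ k.+1) *: (y *m (Phi - mu^-1%:M) ^+ k *m A *m x^T).
Proof.
move=> mu0 yN; set w := y *m _ ^+ k.
have wPhi : w *m Phi = mu^-1 *: w.
  apply/eqP; rewrite -subr_eq0 -mul_mx_scalar -mulmxBr.
  by rewrite /w -mulmxA -[_ *m (_ - _)]exprSr yN.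
have wPsi j : w *m Psi ^+ j = mu ^+ j *: w.
  elim: j => [|j IH]; first by rewrite !expr0 mulmx1 scale1r.
  rewrite exprSr -[_ * Psi]/(_ *m Psi) mulmxA IH -scalemxAl exprSr -scalerA.
  congr (_ *: _); rewrite -[w in LHS]scale1r -(mulfV mu0) -scalerA -wPhi.
  by rewrite -scalemxAl -mulmxA [Phi *m Psi]mulrV // mulmx1.
have -> : x *m (Phi - mu%:M) ^+ k *m A *m y^T =
    (y *m Psi *m (Psi - mu%:M) ^+ k *m A *m x^T)^T.
  rewrite -(horner_XsubC_exp Psi) -(mulmxA (y *m Psi) _ A) Psi_adj.
  rewrite horner_XsubC_exp (mulmxA (y *m Psi)) -(mulmxA y) invPhi_mul.
  by rewrite !trmx_mul !trmxK !mulmxA.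
have -> : y *m Psi *m (Psi - mu%:M) ^+ k = ((- mu) ^+ k * mu ^+ k.+1) *: w.
  rewrite Psi_shift_exp // -scalemxAr -scalerA; congr (_ *: _).
  rewrite -wPsi /w -!mulmxA; congr (_ *m _).
  rewrite !mulmxE exprS !mulrA; congr (_ * _).
  exact/commrX/Psi_Phi_comm.
by rewrite -!scalemxAl linearZ /= [(_ *m x^T)^T]mx11_scalar mxE -mx11_scalar.
Qed.

Lemma self_pairing k mu (z : 'rV[F]_n.+1) : mu != 0 ->
  z *m (Phi - mu%:M) ^+ k.+1 = 0 -> z *m (Phi - mu%:M) ^+ k *m A *m z^T != 0 ->
  mu = mu^-1 /\ mu = (-1) ^+ k.
Proof.
move=> mu0 zN c0; set w := z *m _ ^+ k in c0.
have wPhi : w *m Phi = mu *: w.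
  apply/eqP; rewrite -subr_eq0 -mul_mx_scalar -mulmxBr.
  by rewrite /w -mulmxA -[_ *m (_ - _)]exprSr zN.
have wPsi : w *m (Psi - mu%:M) = (mu^-1 - mu) *: w.
  rewrite mulmxBr mul_mx_scalar scalerBl; congr (_ - _).
  rewrite -[w in LHS]scale1r -(mulVf mu0) -scalerA -wPhi.
  by rewrite -scalemxAl -mulmxA [Phi *m Psi]mulrV // mulmx1.
have mumu : mu = mu^-1.
  have : w *m A *m (z *m (Phi - mu%:M) ^+ k.+1)^T = 0 by rewrite zN trmx0 mulmx0.
  rewrite trmx_mul mulmxA -(mulmxA w) -horner_XsubC_exp -Psi_adj horner_XsubC_exp.
  rewrite mulmxA; have -> j : w *m (Psi - mu%:M) ^+ j = (mu^-1 - mu) ^+ j *: w.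
    elim: j => [|j IH]; first by rewrite !expr0 mulmx1 scale1r.
    rewrite exprSr -[_ ^+ _ * _]/(_ *m (Psi - _)) mulmxA IH -scalemxAl wPsi scalerA.
    by rewrite -exprSr.
  rewrite -!scalemxAl => /eqP; rewrite scaler_eq0 (negPf c0) orbF expf_eq0 /=.
  by rewrite subr_eq0 => /eqP ->.
split=> //; have := pairing_sym z mu0; rewrite -mumu => /(_ k z zN).
rewrite -/w => /eqP; rewrite -subr_eq0 -{1}[_ *m z^T]scale1r -scalerBl scaler_eq0.
rewrite (negPf c0) orbF subr_eq0 => /eqP.
rewrite (exprNn mu) -mulrA -exprD addnS exprS addnn -mul2n exprM.
have -> : mu ^+ 2 = 1 by rewrite expr2 {2}mumu mulfV.
rewrite expr1n mulr1 => e; apply: (@mulfI _ ((-1) ^+ k)); first by rewrite signr_eq0.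
by rewrite -e -expr2 sqrr_sign.
Qed.

Lemma shift_addK a : Phi - a%:M + a%:M = Phi.
Proof. exact: subrK. Qed.

(* k + 1 is the block size; self_pairing forces the sign of Gamma. *)
Lemma Gamma_split k mu (z : 'rV[F]_n.+1) : mu != 0 ->
  z *m (Phi - mu%:M) ^+ k.+1 = 0 -> z *m (Phi - mu%:M) ^+ k *m A *m z^T != 0 ->
  exists m (A' : 'M_m), congruent A (dsum (Gamma F k.+1) A').
Proof.
move=> mu0 zN c0; have [_ emu] := self_pairing mu0 zN c0.
pose X := cyclic_rows k.+1 (Phi - mu%:M) z.
have XL : X *m cosquare A = jordan k.+1 mu *m X.
  by rewrite -cyclic_rows_jordan // shift_addK.
have uG : X *m A *m X^T \in unitmx.
  apply: (gram_unit uA (jordan_unit _ mu0) XL) => a v v0 vL.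
  have [_ ev] := jordan_left_eigen vL v0.
  apply: contraNneq c0 => vG.
  have : v *m X *m A *m z^T = 0.
    have -> : z^T = X^T *m (delta_mx 0 0 : 'rV_k.+1)^T.
      by rewrite -trmx_mul delta_cyclic_rows expr0 mulmx1.
    by rewrite mulmxA -(mulmxA v) -(mulmxA v) vG mul0mx.
  rewrite ev -scalemxAl delta_cyclic_rows -!scalemxAl => /eqP.
  rewrite scaler_eq0 => /orP[/eqP v00|//].
  by move: v0; rewrite ev v00 scale0r eqxx.
have [m [A' c]] := congruent_split uA XL uG.
exists m, A'; apply: congruent_trans c _; apply: congruent_dsum (congruent_refl _).
apply: similar_cosquare_congruent => //; first exact: Gamma_unit.
rewrite (cosquare_gram uA XL uG) emu; apply: similar_sym.
exact: Gamma_cosquare.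
Qed.

Lemma Hmx_split k mu (x y : 'rV[F]_n.+1) : mu != 0 ->
  x *m (Phi - mu%:M) ^+ k.+1 = 0 -> y *m (Phi - mu^-1%:M) ^+ k.+1 = 0 ->
  x *m (Phi - mu%:M) ^+ k *m A *m y^T != 0 ->
  (mu = mu^-1 -> x *m (Phi - mu%:M) ^+ k *m A *m x^T = 0
              /\ y *m (Phi - mu%:M) ^+ k *m A *m y^T = 0) ->
  exists m (A' : 'M_m), congruent A (dsum (Hmx k.+1 mu^-1) A').
Proof.
move=> mu0 xN yN c0 isot.
have muV0 : mu^-1 != 0 by rewrite invr_eq0.
pose X1 := cyclic_rows k.+1 (Phi - mu%:M) x.
pose X2 := cyclic_rows k.+1 (Phi - mu^-1%:M) y.
pose X := col_mx X1 X2; pose L := dsum (jordan k.+1 mu) (jordan k.+1 mu^-1).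
have XL : X *m cosquare A = L *m X.
  rewrite mul_col_mx mul_block_col !mul0mx addr0 add0r.
  by rewrite -!cyclic_rows_jordan // !shift_addK.
have uL : L \in unitmx by rewrite dsum_unit !jordan_unit.
have c0' : y *m (Phi - mu^-1%:M) ^+ k *m A *m x^T != 0.
  by apply: contraNneq c0 => e; rewrite (pairing_sym x mu0 yN) e scaler0.
have uG : X *m A *m X^T \in unitmx.
  apply: (gram_unit uA uL XL) => a v v0 vL; apply/eqP=> vG.
  have [v1 [v2 ev]] : exists v1 v2, v = row_mx v1 v2.
    by exists (lsubmx v), (rsubmx v); rewrite hsubmxK.
  move: vL; rewrite ev mul_row_block !mulmx0 addr0 add0r scale_row_mx.
  case/eq_row_mx=> vL1 vL2.
  have [al [e1 h1]] : exists al, v1 = al *: delta_mx 0 ord_max /\ (al != 0 -> a = mu).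
    have [->|v10] := eqVneq v1 0; first by exists 0; rewrite scale0r eqxx.
    by have [-> e] := jordan_left_eigen vL1 v10; exists (v1 0 ord_max).
  have [be [e2 h2]] : exists be,
      v2 = be *: delta_mx 0 ord_max /\ (be != 0 -> a = mu^-1).
    have [->|v20] := eqVneq v2 0; first by exists 0; rewrite scale0r eqxx.
    by have [-> e] := jordan_left_eigen vL2 v20; exists (v2 0 ord_max).
  have vX : v *m X = al *: (x *m (Phi - mu%:M) ^+ k)
                   + be *: (y *m (Phi - mu^-1%:M) ^+ k).
    by rewrite ev mul_row_col e1 e2 -!scalemxAl !delta_cyclic_rows.
  have vXX : v *m X *m A *m X^T = 0 by rewrite -(mulmxA v) -(mulmxA v).
  have vXx : v *m X *m A *m x^T = 0.
    have -> : x^T = X^T *m (row_mx (delta_mx 0 0 : 'rV_k.+1) 0)^T.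
      by rewrite -trmx_mul mul_row_col mul0mx addr0 delta_cyclic_rows expr0 mulmx1.
    by rewrite mulmxA vXX mul0mx.
  have vXy : v *m X *m A *m y^T = 0.
    have -> : y^T = X^T *m (row_mx 0 (delta_mx 0 0 : 'rV_k.+1))^T.
      by rewrite -trmx_mul mul_row_col mul0mx add0r delta_cyclic_rows expr0 mulmx1.
    by rewrite mulmxA vXX mul0mx.
  move: vXx vXy; rewrite vX !mulmxDl -!scalemxAl.
  have [mumu|nmumu] := eqVneq mu mu^-1.
    have [i1 i2] := isot mumu.
    rewrite -mumu i1 i2 !scaler0 addr0 add0r => /eqP; rewrite mumu scaler_eq0.
    rewrite (negPf c0') orbF => /eqP b0 /eqP; rewrite scaler_eq0 -mumu (negPf c0) orbF.
    by move=> /eqP a0; move: v0; rewrite ev e1 e2 a0 b0 !scale0r row_mx0 eqxx.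
  have [al0|al0] := eqVneq al 0.
    rewrite al0 !scale0r !add0r => /eqP; rewrite scaler_eq0 (negPf c0') orbF.
    by move=> /eqP b0; move: v0; rewrite ev e1 e2 al0 b0 !scale0r row_mx0 eqxx.
  have [be0|be0] := eqVneq be 0; last by case/eqP: nmumu; rewrite -(h2 be0) (h1 al0).
  rewrite be0 !scale0r !addr0 => _ /eqP; rewrite scaler_eq0 (negPf c0) orbF.
  by rewrite (negPf al0).
have [m [A' c]] := congruent_split uA XL uG.
exists m, A'; apply: congruent_trans c _; apply: congruent_dsum (congruent_refl _).
have [uH eH] := Hmx_cosquare k.+1 muV0.
apply: similar_cosquare_congruent => //.
rewrite (cosquare_gram uA XL uG) eH; apply: similar_dsum (similar_refl _).
by apply: similar_sym; rewrite -[mu in X in similar_mx _ X]invrK;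
  apply: jordan_tr_inv_similar.
Qed.

Lemma regular_step :
  (exists k m (A' : 'M_m), congruent A (dsum (Gamma F k.+1) A')) \/
  (exists k a m (A' : 'M_m),
     [/\ a != 0, a != (-1) ^+ k & congruent A (dsum (Hmx k.+1 a) A')]).
Proof.
have [k [mu [x [y [mu0 xN yN c0]]]]] := jordan_pair.
pose c (z z' : 'rV[F]_n.+1) := z *m (Phi - mu%:M) ^+ k *m A *m z'^T.
have [mumu|nmumu] := eqVneq mu mu^-1; last first.
  right; exists k, mu^-1.
  have [m [A' cA]] := Hmx_split mu0 xN yN c0 (fun e => False_ind _ (elimN eqP nmumu e)).
  exists m, A'; split=> //; rewrite ?invr_eq0 //.
  apply: contraNneq nmumu => e.
  have em : mu = (-1) ^+ k by rewrite -[LHS]invrK e -exprVn invrN1.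
  by rewrite em -exprVn invrN1.
have yN' : y *m (Phi - mu%:M) ^+ k.+1 = 0 by rewrite mumu.
have G z := @Gamma_split k mu z mu0.
have [cx|cx] := eqVneq (c x x) 0; last by left; exists k; apply: (G x).
have [cy|cy] := eqVneq (c y y) 0; last by left; exists k; apply: (G y).
have [cxy|cxy] := eqVneq (c (x + y) (x + y)) 0; last first.
  by left; exists k; apply: (G (x + y)); rewrite // mulmxDl xN yN' addr0.
right; exists k, mu^-1.
have [m [A' cA]] := Hmx_split mu0 xN yN c0 (fun _ => conj cx cy).
exists m, A'; split=> //; rewrite ?invr_eq0 // -mumu.
apply: contraNneq c0 => e.
have sym := pairing_sym x mu0 yN.
have f1 : (- mu) ^+ k * mu ^+ k.+1 = 1.
  rewrite exprNn -mulrA -exprD addnS exprS addnn -mul2n exprM.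
  have -> : mu ^+ 2 = 1 by rewrite expr2 {2}mumu mulfV.
  by rewrite expr1n mulr1 e -expr2 sqrr_sign.
rewrite f1 scale1r -mumu in sym.
move: cxy; rewrite /c linearD /= !mulmxDl !mulmxDr.
rewrite -/(c x x) -/(c y y) -/(c x y) -/(c y x) cx cy add0r addr0.
rewrite /c -sym -mulr2n -scaler_nat => /eqP.
by rewrite scaler_eq0 (negPf two_neq0).
Qed.

End Pair.

Definition H_block (t : nat * F) : 'M[F]_(t.1 + t.1) := Hmx t.1 t.2.

Lemma regular_canonical n (A : 'M[F]_n) : A \in unitmx ->
  exists (hs : seq (nat * F)) (gs : seq nat),
  [/\ all (fun t => [&& (0 < t.1)%N, t.2 != 0 & t.2 != (-1) ^+ t.1.+1]) hs,
      all (leq 1) gs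
    & congruent A (dsum (bdiag H_block hs) (bdiag (Gamma F) gs))].
Proof.
elim/ltn_ind: n => [[|n]] IH in A *.
  by move=> _; exists [::], [::]; split=> //; apply: congruent_dim0.
move=> uA; have [[k [m [A' c]]]|[k [a [m [A' [a0 ak c]]]]]] := regular_step uA.
  have dim := congruent_dim c.
  have uA' : A' \in unitmx.
    by move: uA; rewrite (congruent_unit c) dsum_unit => /andP[].
  have mn : (m < n.+1)%N by rewrite dim; lia.
  have [hs [gs [hs0 gs0 c']]] := IH m mn A' uA'.
  exists hs, (k.+1 :: gs); split=> //.
  apply: congruent_trans c _.
  apply: congruent_trans (congruent_dsum (congruent_refl _) c') _.
  apply: congruent_trans (congruent_dsumA _ _ _) _.
  apply: congruent_trans
    (congruent_dsum (congruent_dsumC _ _) (congruent_refl _)) _.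
  exact: congruent_sym (congruent_dsumA _ _ _).
have dim := congruent_dim c.
have uA' : A' \in unitmx.
  by move: uA; rewrite (congruent_unit c) dsum_unit => /andP[].
have mn : (m < n.+1)%N by rewrite dim; lia.
have [hs [gs [hs0 gs0 c']]] := IH m mn A' uA'.
exists ((k.+1, a) :: hs), gs; split=> //=.
  by rewrite a0 hs0 !exprS mulrA mulrNN !mul1r ak.
apply: congruent_trans c _.
apply: congruent_trans (congruent_dsum (congruent_refl _) c') _.
exact: congruent_dsumA.
Qed.

End Regular.

(** * Congruence invariants *)

Section Chain.
Variable F : fieldType.

Fixpoint chain n (A : 'M[F]_n) (a : F) (j : nat) : 'M[F]_n :=
  if j is j'.+1 then kermx ((A - a *: A^T) *m cokermx (chain A a j' *m A^T)) else 0.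

Lemma sub_chainS m n (A : 'M[F]_n) a j (v : 'M_(m, n)) :
  (v <= chain A a j.+1)%MS = (v *m (A - a *: A^T) <= chain A a j *m A^T)%MS.
Proof. by rewrite /= sub_kermx mulmxA submxE. Qed.

Lemma chain_congr m n (A : 'M[F]_m) (B : 'M[F]_n) (S : 'M_(m, n)) (T : 'M_(n, m))
    a j : S *m T = 1%:M -> T *m S = 1%:M -> A = S *m B *m S^T ->
  (chain A a j *m S :=: chain B a j)%MS.
Proof.
move=> ST TS eA.
have freeST : row_free S^T by apply/row_freeP; exists T^T; rewrite -trmx_mul TS trmx1.
have freeS : row_free S by apply/row_freeP; exists T.
elim: j => [|j IH]; first by rewrite mul0mx; apply: eqmx0.
apply/eqmxP/rV_eqP => u.
have -> : (u <= chain A a j.+1 *m S)%MS = (u *m T <= chain A a j.+1)%MS.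
  by rewrite -{1}[u]mulmx1 -TS mulmxA submxMfree.
rewrite !sub_chainS; have -> : chain A a j *m A^T = chain A a j *m S *m B^T *m S^T.
  by rewrite eA !trmx_mul trmxK !mulmxA.
have -> : u *m T *m (A - a *: A^T) = u *m (B - a *: B^T) *m S^T.
  have -> : A - a *: A^T = S *m (B - a *: B^T) *m S^T.
    by rewrite eA !trmx_mul trmxK mulmxBr mulmxBl -scalemxAr -scalemxAl !mulmxA.
  by rewrite !mulmxA -(mulmxA u) TS mulmx1.
by rewrite submxMfree // (eqmxMr B^T IH).
Qed.

Definition chain_rank n (A : 'M[F]_n) a j := \rank (chain A a j).
Definition chain_rank_tr n (A : 'M[F]_n) a j := \rank (chain A a j *m A^T).

Lemma chain_rank_congr m n (A : 'M[F]_m) (B : 'M[F]_n) a j :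
  congruent A B -> chain_rank A a j = chain_rank B a j.
Proof.
move=> [S [T [ST TS eA]]].
rewrite /chain_rank -(chain_congr a j ST TS eA) mxrankMfree //.
by apply/row_freeP; exists T.
Qed.

Lemma chain_rank_tr_congr m n (A : 'M[F]_m) (B : 'M[F]_n) a j :
  congruent A B -> chain_rank_tr A a j = chain_rank_tr B a j.
Proof.
move=> [S [T [ST TS eA]]]; rewrite /chain_rank_tr.
rewrite -(eqmxMr B^T (chain_congr a j ST TS eA)) {2}eA !trmx_mul trmxK !mulmxA.
by rewrite mxrankMfree //; apply/row_freeP; exists T^T; rewrite -trmx_mul TS trmx1.
Qed.

Lemma sub_dsum l m n (u : 'M[F]_(l, m)) (v : 'M_(l, n)) (A : 'M_m) (B : 'M_n) :
  (row_mx u v <= dsum A B)%MS = (u <= A)%MS && (v <= B)%MS.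
Proof.
apply/submxP/andP => [[D]|[/submxP[D ->] /submxP[D' ->]]].
  rewrite -[D]hsubmxK mul_row_block !mulmx0 addr0 add0r => /eq_row_mx[-> ->].
  by rewrite !submxMl.
by exists (row_mx D D'); rewrite mul_row_block !mulmx0 addr0 add0r.
Qed.

Lemma chain_dsum m n (A : 'M[F]_m) (B : 'M[F]_n) a j :
  (chain (dsum A B) a j :=: dsum (chain A a j) (chain B a j))%MS.
Proof.
elim: j => [|j IH]; first by rewrite /= /dsum block_mx0.
apply/eqmxP/rV_eqP => u; rewrite -[u]hsubmxK sub_dsum !sub_chainS.
rewrite (eqmxMr _ IH) tr_dsum mul_dsum -sub_dsum.
by rewrite /dsum scale_block_mx opp_block_mx add_block_mx !(scaler0, oppr0, addr0)
  mul_row_block !(mulmx0, addr0, add0r).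
Qed.

Lemma chain_rank_dsum m n (A : 'M[F]_m) (B : 'M[F]_n) a j :
  chain_rank (dsum A B) a j = (chain_rank A a j + chain_rank B a j)%N.
Proof. by rewrite /chain_rank chain_dsum rank_diag_block_mx. Qed.

Lemma chain_rank_tr_dsum m n (A : 'M[F]_m) (B : 'M[F]_n) a j :
  chain_rank_tr (dsum A B) a j = (chain_rank_tr A a j + chain_rank_tr B a j)%N.
Proof.
rewrite /chain_rank_tr (eqmxMr _ (chain_dsum A B a j)) tr_dsum mul_dsum.
by rewrite rank_diag_block_mx.
Qed.

Lemma chain_rank_mxdiag p (d : 'I_p -> nat) (M : forall i, 'M[F]_(d i)) a j :
  chain_rank (\mxdiag_(i < p) M i) a j = (\sum_(i < p) chain_rank (M i) a j)%N.
Proof.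
rewrite (chain_rank_congr a j (mxdiag_bdiag M)) -big_enum /=.
elim: (enum _) => [|i s IH]; first by rewrite big_nil /chain_rank flatmx0 mxrank0.
by rewrite big_cons /= chain_rank_dsum IH.
Qed.

Lemma chain_rank_tr_mxdiag p (d : 'I_p -> nat) (M : forall i, 'M[F]_(d i)) a j :
  chain_rank_tr (\mxdiag_(i < p) M i) a j
  = (\sum_(i < p) chain_rank_tr (M i) a j)%N.
Proof.
rewrite (chain_rank_tr_congr a j (mxdiag_bdiag M)) -big_enum /=.
elim: (enum _) => [|i s IH]; first by rewrite big_nil /chain_rank_tr flatmx0 mxrank0.
by rewrite big_cons /= chain_rank_tr_dsum IH.
Qed.

Lemma rank_coordinate_space m n (M : 'M[F]_(m, n)) (P : pred 'I_n) :
    (forall v : 'rV_n, (v <= M)%MS = [forall c, (v 0 c != 0) ==> P c]) ->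
  \rank M = #|P|.
Proof.
move=> h; pose X : 'M[F]_(#|P|, n) := \matrix_i delta_mx 0 (enum_val i).
have XX : X *m X^T = 1%:M.
  apply/matrixP=> i j; rewrite !mxE (bigD1 (enum_val i)) //= !mxE !eqxx mul1r.
  rewrite big1 => [|c ci]; last by rewrite !mxE (negPf ci) andbF mul0r.
  by rewrite addr0 (inj_eq enum_val_inj).
have freeX : row_free X by apply/row_freeP; exists X^T.
rewrite -(eqP freeX); suff -> : (M :=: X)%MS by [].
apply/eqmxP/rV_eqP => u; rewrite h; apply/forallP/submxP => [uP|[D ->] c].
  apply/submxP; rewrite [u]row_sum_delta summx_sub // => c _.
  have [->|/(implyP (uP c)) Pc] := eqVneq (u 0 c) 0; first by rewrite scale0r sub0mx.
  rewrite scalemx_sub // (eq_row_sub (enum_rank_in Pc c)) // rowK.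
  by rewrite enum_rankK_in.
apply/implyP; apply: contraNT => nPc; rewrite mxE big1 // => i _; rewrite !mxE eqxx /=.
by case: eqP => [e|_]; rewrite ?mulr0 //; case/negP: nPc;
   rewrite e; apply: (enum_valP i).
Qed.

Lemma card_add_point r t (P : pred 'I_r) : (0 < t)%N ->
  (forall c, P c -> (r - c != t)%N) ->
  #|[pred c : 'I_r | P c || (r - c == t)%N]| = (#|P| + (t <= r))%N.
Proof.
move=> t0 h; have [tr|tr] := leqP t r; last first.
  rewrite addn0; apply: eq_card => c; rewrite !inE; case: eqP => [e|]; rewrite ?orbF //.
  lia.
have lt : (r - t < r)%N by lia.
rewrite addnC -(_ : (Ordinal lt \notin P) = true :> nat) -?cardU1; last first.
  by rewrite unfold_in; case: (boolP (P _)) => // /h /=; rewrite subKn ?eqxx.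
apply: eq_card => c; rewrite !inE orbC -val_eqE /=; congr (_ || _).
by apply/eqP/eqP; have := ltn_ord c; lia.
Qed.

Lemma mul_row_jordan0_tr n (v : 'rV[F]_n) (i j : 'I_n) :
  i.+1 = j -> (v *m (jordan n 0)^T) 0 i = v 0 j.
Proof.
move=> ij; rewrite mxE (bigD1 j) //= mxE jordan0E ij eqxx mulr1 big1 ?addr0 //.
by move=> l lj; rewrite mxE jordan0E ij eq_sym val_eqE (negPf lj) mulr0.
Qed.

Lemma mul_row_jordan0_tr_last n (v : 'rV[F]_n) (i : 'I_n) :
  i.+1 = n -> (v *m (jordan n 0)^T) 0 i = 0.
Proof.
by move=> e; rewrite mxE big1 // => l _; rewrite mxE jordan0E e gtn_eqF ?mulr0.
Qed.

Lemma sub_chain_jordan_tr r j :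
  (forall v : 'rV[F]_r, (v <= chain (jordan r 0) 0 j)%MS =
     [forall c, (v 0 c != 0) ==> (odd (r - c) && (r - c < j.*2)%N)]) ->
  forall v : 'rV[F]_r, (v <= chain (jordan r 0) 0 j *m (jordan r 0)^T)%MS =
     [forall c, (v 0 c != 0) ==> (~~ odd (r - c) && (r - c <= j.*2)%N)].
Proof.
move=> h v; apply/idP/forallP => [/submxP[D ev] c|hv].
  apply/implyP; rewrite ev mulmxA; set u := D *m _.
  have : (u <= chain (jordan r 0) 0 j)%MS by apply: submxMl.
  rewrite h => /forallP hu.
  have [lt|ge] := ltnP c.+1 r; last first.
    by rewrite mul_row_jordan0_tr_last ?eqxx //; have := ltn_ord c; lia.
  rewrite (@mul_row_jordan0_tr _ _ _ (Ordinal lt)) // => u0.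
  by have /implyP/(_ u0)/= := hu (Ordinal lt); lia.
have -> : v = v *m jordan r 0 *m (jordan r 0)^T.
  apply/rowP=> c; have [lt|ge] := ltnP c.+1 r.
    by rewrite (@mul_row_jordan0_tr _ _ _ (Ordinal lt)) // (@mul_row_jordan0 _ _ _ c).
  rewrite mul_row_jordan0_tr_last; last by have := ltn_ord c; lia.
  apply/eqP/negPn/negP=> v0; have /implyP/(_ v0) := hv c.
  by have := ltn_ord c; lia.
apply: submxMr; rewrite h; apply/forallP=> c; apply/implyP.
have [c0|c0] := posnP c; first by rewrite mul_row_jordan0_0 ?eqxx.
have lt : (c.-1 < r)%N by have := ltn_ord c; lia.
rewrite (@mul_row_jordan0 _ _ _ (Ordinal lt)) ?prednK // => v0.
by have /implyP/(_ v0)/= := hv (Ordinal lt); lia.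
Qed.

Lemma sub_chain_jordan r j (v : 'rV[F]_r) : (v <= chain (jordan r 0) 0 j)%MS =
  [forall c, (v 0 c != 0) ==> (odd (r - c) && (r - c < j.*2)%N)].
Proof.
elim: j v => [|j IH] v.
  rewrite submx0; apply/eqP/forallP => [-> c|hv]; first by rewrite mxE eqxx.
  apply/rowP=> c; rewrite mxE; apply/eqP/negPn/negP => v0.
  by have /implyP/(_ v0) := hv c; rewrite ltn0 andbF.
rewrite sub_chainS scale0r subr0 (sub_chain_jordan_tr IH).
apply/forallP/forallP => hv c; apply/implyP => v0.
  have [lt|ge] := ltnP c.+1 r; last by have := ltn_ord c; lia.
  have := hv (Ordinal lt); rewrite (@mul_row_jordan0 _ _ _ c) // v0 /=; lia.
have [c0|c0] := posnP c; first by move: v0; rewrite mul_row_jordan0_0 ?eqxx.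
have lt : (c.-1 < r)%N by have := ltn_ord c; lia.
move: v0; rewrite (@mul_row_jordan0 _ _ _ (Ordinal lt)) ?prednK // => v0.
by have /implyP/(_ v0)/= := hv (Ordinal lt); lia.
Qed.

Lemma chain_rank_jordanS r j : chain_rank (jordan r 0) 0 j.+1 =
  (chain_rank (jordan r (0 : F)) 0 j + (j.*2.+1 <= r))%N.
Proof.
rewrite /chain_rank !(rank_coordinate_space (sub_chain_jordan _)).
rewrite -card_add_point //; last by move=> c /=; lia.
by apply: eq_card => c; rewrite !inE; apply/idP/idP; lia.
Qed.

Lemma chain_rank_tr_jordanS r j : chain_rank_tr (jordan r 0) 0 j.+1 =
  (chain_rank_tr (jordan r (0 : F)) 0 j + (j.*2.+2 <= r))%N.
Proof.
rewrite /chain_rank_tr.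
rewrite !(rank_coordinate_space (sub_chain_jordan_tr (sub_chain_jordan _))).
rewrite -card_add_point //; last by move=> c /=; lia.
by apply: eq_card => c; rewrite !inE; apply/idP/idP; lia.
Qed.

End Chain.

Section RegularChain.
Variable F : closedFieldType.

Lemma chain_unit n (A : 'M[F]_n) a j : A \in unitmx ->
  (chain A a j :=: kermx ((cosquare A - a%:M) ^+ j))%MS.
Proof.
move=> uA; have uAT : A^T \in unitmx by rewrite unitmx_tr.
have eA : A - a *: A^T = (cosquare A - a%:M) *m A^T.
  by rewrite mulmxBl cosquareK // mul_scalar_mx.
elim: j => [|j IH].
  rewrite expr0 /=; apply/eqmxP/rV_eqP => u.
  by rewrite submx0 sub_kermx mulmx1.
apply/eqmxP/rV_eqP => u; rewrite sub_chainS eA mulmxA.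
rewrite submxMfree ?row_free_unit // IH !sub_kermx exprS.
by rewrite -[_ * _]/(_ *m _) mulmxA.
Qed.

Lemma chain_rank_unit n (A : 'M[F]_n) a j : A \in unitmx ->
  chain_rank A a j = (n - \rank ((cosquare A - a%:M) ^+ j))%N.
Proof. by move=> uA; rewrite /chain_rank chain_unit // mxrank_ker. Qed.

Lemma chain_rank_unit0 n (A : 'M[F]_n) j : A \in unitmx ->
  chain_rank A 0 j = 0%N /\ chain_rank_tr A 0 j = 0%N.
Proof.
move=> uA; rewrite /chain_rank /chain_rank_tr (eqmxMr _ (chain_unit 0 j uA)).
rewrite chain_unit //.
have -> : kermx ((cosquare A - 0%:M) ^+ j) = 0.
  apply/eqP; rewrite raddf0 subr0; rewrite kermx_eq0 row_free_unit.
  elim: j => [|j IH]; first by rewrite expr0 unitmx1.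
  by rewrite exprS unitmx_mul cosquare_unit.
by rewrite mul0mx mxrank0.
Qed.

Lemma similar_shift_rank m n (A : 'M[F]_m) (B : 'M[F]_n) a j : similar_mx A B ->
  \rank ((A - a%:M) ^+ j) = \rank ((B - a%:M) ^+ j).
Proof.
move=> [S [T [ST TS ->]]].
have -> : S *m B *m T - a%:M = S *m (B - a%:M) *m T.
  by rewrite mulmxBr mulmxBl mul_mx_scalar -scalemxAl ST scalemx1.
have e : (S *m (B - a%:M) *m T) ^+ j = S *m (B - a%:M) ^+ j *m T.
  elim: j => [|j IH]; first by rewrite !expr0 mulmx1 ST.
  rewrite exprSr IH exprSr; set C := B - _.
  transitivity (S *m C ^+ j *m T *m (S *m C *m T)) => //.
  by rewrite !mulmxA -(mulmxA _ T S) TS mulmx1 -(mulmxA S).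
rewrite e mxrankMfree; last by apply/row_freeP; exists S.
by rewrite eqmxMfull //; apply/row_fullP; exists T.
Qed.

Lemma dsum_shift_rank m n (A : 'M[F]_m) (B : 'M[F]_n) a j :
  \rank ((dsum A B - a%:M) ^+ j) =
  (\rank ((A - a%:M) ^+ j) + \rank ((B - a%:M) ^+ j))%N.
Proof.
have -> : (dsum A B - a%:M) ^+ j = dsum ((A - a%:M) ^+ j) ((B - a%:M) ^+ j).
  elim: j => [|j IH]; first by rewrite !expr0 dsum1.
  rewrite !exprSr IH -[_ * _]/(_ *m _) /dsum scalar_mx_block opp_block_mx.
  by rewrite add_block_mx !oppr0 !addr0 [LHS]mul_dsum.
by rewrite rank_diag_block_mx.
Qed.

Lemma jordan_shift_rank n (a b : F) j :
  \rank ((jordan n a - b%:M) ^+ j) = (n - (b == a) * minn j n)%N.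
Proof.
rewrite jordanE -addrA -raddfB -jordanE; have [->|ba] := eqVneq b a; last first.
  rewrite mul0n subn0; apply/eqP; rewrite -/(row_free _) row_free_unit.
  have u : jordan n (a - b) \in unitmx by rewrite jordan_unit // subr_eq0 eq_sym.
  elim: j => [|j IH]; first by rewrite expr0 unitmx1.
  by rewrite exprS unitmx_mul u.
rewrite subrr mul1n (@rank_coordinate_space _ _ _ _ [pred c : 'I_n | (j <= c)%N]).
  rewrite cardE size_filter -enumT -(count_map val (leq j)) val_enum_ord.
  elim: n => [|n IH]; first by rewrite sub0n.
  by rewrite -addn1 iotaD count_cat IH /=; lia.
move=> v; apply/submxP/forallP => [[D ->] c|hv].
  apply/implyP; apply: contraNT; rewrite /= -ltnNge mxE => cj.
  rewrite big1 // => i _; rewrite jordan0_exp gtn_eqF ?mulr0 //.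
  by rewrite (leq_trans cj) ?leq_addl.
exists (v *m (jordan n 0 ^+ j)^T); apply/rowP=> c; rewrite mxE.
have [jc|cj] := leqP j c; last first.
  rewrite big1 => [|i _].
    by apply/eqP/negPn/negP => /(implyP (hv c)); rewrite /= leqNgt cj.
  by rewrite jordan0_exp gtn_eqF ?mulr0 // (leq_trans cj) ?leq_addl.
have lt : (c - j < n)%N by have := ltn_ord c; lia.
rewrite (bigD1 (Ordinal lt)) //= jordan0_exp /= subnK // eqxx mulr1.
rewrite [X in _ + X]big1 ?addr0 => [|i]; last first.
  rewrite -val_eqE jordan0_exp /= => ne.
  rewrite [_ == _ :> nat](_ : _ = false) ?mulr0 //.
  by lia.
rewrite mxE (bigD1 c) //= mxE jordan0_exp /= subnK // eqxx mulr1 big1 ?addr0 // => i ic.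
by rewrite mxE jordan0_exp /= subnK // val_eqE eq_sym (negPf ic) mulr0.
Qed.

Hypothesis two_neq0 : 2%:R != 0 :> F.

Lemma chain_rank_Gamma n (a : F) j : (0 < n)%N ->
  chain_rank (Gamma F n) a j = ((a == (-1) ^+ n.-1) * minn j n)%N.
Proof.
case: n => // n _; rewrite chain_rank_unit ?Gamma_unit //.
rewrite (similar_shift_rank _ _ (Gamma_cosquare two_neq0 n)) jordan_shift_rank.
by case: eqP => _ /=; lia.
Qed.

Lemma Hmx_cosquare_similar m (b : F) : (0 < m)%N -> b != 0 -> Hmx m b \in unitmx /\
  similar_mx (cosquare (Hmx m b)) (dsum (jordan m b^-1) (jordan m b)).
Proof.
case: m => // m _ b0; have [uH ->] := Hmx_cosquare m.+1 b0; split=> //.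
by apply: similar_dsum (jordan_tr_inv_similar _ b0) (similar_refl _).
Qed.

Lemma chain_rank_Hmx m (b a : F) j : (0 < m)%N -> b != 0 ->
  chain_rank (Hmx m b) a j = (((a == b^-1) + (a == b)) * minn j m)%N.
Proof.
move=> m0 b0; have [uH sH] := Hmx_cosquare_similar m0 b0.
rewrite chain_rank_unit // (similar_shift_rank _ _ sH).
rewrite dsum_shift_rank !jordan_shift_rank.
by case: eqP; case: eqP => _ _ /=; lia.
Qed.

Lemma Hmx_inv_congruent m (b : F) : (0 < m)%N -> b != 0 ->
  congruent (Hmx m b) (Hmx m b^-1).
Proof.
move=> m0 b0; have bV0 : b^-1 != 0 by rewrite invr_eq0.
have [u1 s1] := Hmx_cosquare_similar m0 b0.
have [u2 s2] := Hmx_cosquare_similar m0 bV0; rewrite invrK in s2.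
apply: (similar_cosquare_congruent two_neq0) => //.
apply: similar_trans s1 _; apply: similar_trans (similar_dsumC _ _) _.
exact: similar_sym.
Qed.

End RegularChain.

(** * Uniqueness *)

Section Canonical.
Variable F : closedFieldType.
Hypothesis two_neq0 : 2%:R != 0 :> F.
Implicit Types d : canon_data F.

Definition canon d := (canon_E d).2.

Lemma exists_bij_of_counts (T : eqType) p q (f : 'I_p -> T) (g : 'I_q -> T) :
    (forall i, \sum_(k < p) (f k == f i) = \sum_(k < q) (g k == f i))%N ->
    (forall i, \sum_(k < p) (f k == g i) = \sum_(k < q) (g k == g i))%N ->
  exists2 s : 'I_p -> 'I_q, bijective s & forall i, g (s i) = f i.
Proof.
move=> hf hg.
have cnt r (h : 'I_r -> T) x : count_mem x (codom h) = (\sum_(k < r) (h k == x))%N.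
  by rewrite count_map -sum1_count big_mkcond big_enum.
have : perm_eq [tuple f i | i < p] [tuple g i | i < q].
  apply/allP=> x; rewrite mem_cat /= => /orP[]/mapP[i _ ->] /=.
    by rewrite !cnt hf.
  by rewrite !cnt hg.
move=> pe; have pq : p = q by have := perm_size pe; rewrite !size_tuple.
subst q; case/tuple_permP: pe => s /val_inj e.
exists s; first by exists (s^-1)%g; [exact: permK | exact: permKV].
by move=> i; have := congr1 (fun t => tnth t i) e; rewrite !tnth_mktuple.
Qed.

Lemma chain_rank_canon d a j : chain_rank (canon d) a j =
  (\sum_(i < cp d) chain_rank (Hmx (cm i) (cmu i)) a j +
   \sum_(i < cq d) chain_rank (Gamma F (cn i)) a j +
   \sum_(i < cr d) chain_rank (jordan (crk i) 0) a j)%N.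
Proof.
by rewrite /canon /= !chain_rank_dsum !chain_rank_mxdiag.
Qed.

Lemma chain_rank_tr_canon d a j : chain_rank_tr (canon d) a j =
  (\sum_(i < cp d) chain_rank_tr (Hmx (cm i) (cmu i)) a j +
   \sum_(i < cq d) chain_rank_tr (Gamma F (cn i)) a j +
   \sum_(i < cr d) chain_rank_tr (jordan (crk i) 0) a j)%N.
Proof.
by rewrite /canon /= !chain_rank_tr_dsum !chain_rank_tr_mxdiag.
Qed.

Lemma chain_rank_canon0 d j : admissible d ->
  chain_rank (canon d) 0 j =
    (\sum_(i < cr d) chain_rank (jordan (crk i) (0%R : F)) 0 j)%N /\
  chain_rank_tr (canon d) 0 j =
    (\sum_(i < cr d) chain_rank_tr (jordan (crk i) (0%R : F)) 0 j)%N.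
Proof.
case=> cm0 cn0 _ cmu0; rewrite chain_rank_canon chain_rank_tr_canon.
have uH (i : 'I_(cp d)) : Hmx (cm i) (cmu i) \in unitmx.
  by have [uH _] := Hmx_cosquare_similar (cm0 i) (proj1 (cmu0 i)).
have uG (i : 'I_(cq d)) : Gamma F (cn i) \in unitmx.
  by case: (cn i) (cn0 i) => // n _; apply: Gamma_unit.
split; rewrite [X in (X + _ + _)%N]big1 ?[X in (_ + X + _)%N]big1 // => i _.
- by have [-> _] := chain_rank_unit0 j (uG i).
- by have [-> _] := chain_rank_unit0 j (uH i).
- by have [_ ->] := chain_rank_unit0 j (uG i).
- by have [_ ->] := chain_rank_unit0 j (uH i).
Qed.

Lemma sum_eq_geq p (f : 'I_p -> nat) t :
  (\sum_(i < p) (f i == t) + \sum_(i < p) (t < f i) = \sum_(i < p) (t <= f i))%N.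
Proof. by rewrite -big_split; apply: eq_bigr => i _ /=; lia. Qed.

Lemma sum_minn p (w f : 'I_p -> nat) t :
  (\sum_(i < p) w i * minn t (f i) + \sum_(i < p) w i * minn t.+2 (f i) +
   \sum_(i < p) w i * (f i == t.+1) =
   \sum_(i < p) w i * minn t.+1 (f i) + \sum_(i < p) w i * minn t.+1 (f i))%N.
Proof.
rewrite -!big_split; apply: eq_bigr => i _ /=; rewrite -!mulnDr.
by congr (_ * _)%N; lia.
Qed.

Lemma nilpotent_part_unique d d' : admissible d -> admissible d' ->
  congruent (canon d) (canon d') ->
  exists2 s : 'I_(cr d) -> 'I_(cr d'), bijective s & forall k, crk (s k) = crk k.
Proof.
move=> ad ad' c.
have geq t : (\sum_(i < cr d) (t < crk i) = \sum_(i < cr d') (t < crk i))%N.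
  rewrite -[t]odd_double_half; set j := t./2; case: (odd t) => /=.
    have [_ e1] := chain_rank_canon0 j ad; have [_ e1'] := chain_rank_canon0 j ad'.
    have [_ e2] := chain_rank_canon0 j.+1 ad.
    have [_ e2'] := chain_rank_canon0 j.+1 ad'.
    move: e1 e2; rewrite !(chain_rank_tr_congr _ _ c) e1' e2'.
    have S p (f : 'I_p -> nat) :
        (\sum_(i < p) chain_rank_tr (jordan (f i) (0%R : F)) 0 j.+1 =
         \sum_(i < p) chain_rank_tr (jordan (f i) (0%R : F)) 0 j +
         \sum_(i < p) (j.*2.+1 < f i))%N.
      by rewrite -big_split; apply: eq_bigr => i _; rewrite chain_rank_tr_jordanS.
    by rewrite !S => -> /addnI ->.
  have [e1 _] := chain_rank_canon0 j ad; have [e1' _] := chain_rank_canon0 j ad'.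
  have [e2 _] := chain_rank_canon0 j.+1 ad; have [e2' _] := chain_rank_canon0 j.+1 ad'.
  move: e1 e2; rewrite !(chain_rank_congr _ _ c) e1' e2'.
  have S p (f : 'I_p -> nat) :
      (\sum_(i < p) chain_rank (jordan (f i) (0%R : F)) 0 j.+1 =
       \sum_(i < p) chain_rank (jordan (f i) (0%R : F)) 0 j +
       \sum_(i < p) (j.*2 < f i))%N.
    by rewrite -big_split; apply: eq_bigr => i _; rewrite chain_rank_jordanS.
  by rewrite !S => -> /addnI ->.
have eqt t : (0 < t)%N ->
    (\sum_(i < cr d) (crk i == t) = \sum_(i < cr d') (crk i == t))%N.
  case: t => // t _; apply: (@addIn (\sum_(i < cr d') (t.+1 < crk i))%N).
  by rewrite -{1}geq !sum_eq_geq; apply: geq.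
have [_ _ r0 _] := ad; have [_ _ r0' _] := ad'.
by apply: exists_bij_of_counts => i; apply: eqt.
Qed.

Lemma sum_bij (T : Type) p q (f : 'I_p -> T) (g : 'I_q -> T) (s : 'I_p -> 'I_q)
    (h : T -> nat) : bijective s -> (forall i, g (s i) = f i) ->
  (\sum_(i < p) h (f i) = \sum_(i < q) h (g i))%N.
Proof.
move=> bs e; rewrite [RHS](reindex s) /=; last exact: onW_bij.
by apply: eq_bigr => i _; rewrite e.
Qed.

Lemma addrV_eq (a b : F) : a != 0 -> b != 0 ->
  (b + b^-1 == a + a^-1) = (a == b) || (a == b^-1).
Proof.
move=> a0 b0; apply/eqP/orP => [e|[/eqP->|/eqP->] //]; last by rewrite invrK addrC.
have : (a - b) * (a - b^-1) = 0.
  have -> : (a - b) * (a - b^-1) = a * (a - (b + b^-1)) + b * b^-1 by ring.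
  by rewrite e opprD addNKr mulrN !mulfV // addNr.
by move/eqP; rewrite mulf_eq0 !subr_eq0 => /orP.
Qed.

Lemma regular_part_unique d d' : admissible d -> admissible d' ->
  congruent (canon d) (canon d') ->
  (exists2 s : 'I_(cp d) -> 'I_(cp d'), bijective s &
        forall i, cm (s i) = cm i /\
                  (cmu (s i) = cmu i \/ cmu (s i) = (cmu i)^-1)) /\
  (exists2 s : 'I_(cq d) -> 'I_(cq d'), bijective s & forall j, cn (s j) = cn j).
Proof.
move=> ad ad' c; have [sr bsr hsr] := nilpotent_part_unique ad ad' c.
pose cH (d : canon_data F) a t :=
  (\sum_(i < cp d) ((a == (cmu i)^-1) + (a == cmu i)) * (cm i == t))%N.
pose cG (d : canon_data F) a t :=
  (\sum_(i < cq d) (a == (-1) ^+ (cn i).-1 :> F) * (cn i == t))%N.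
pose reg (d : canon_data F) a j :=
  (\sum_(i < cp d) ((a == (cmu i)^-1) + (a == cmu i)) * minn j (cm i) +
   \sum_(i < cq d) (a == (-1) ^+ (cn i).-1 :> F) * minn j (cn i))%N.
have eqreg a j : reg d a j = reg d' a j.
  have e d0 : admissible d0 -> chain_rank (canon d0) a j =
      (reg d0 a j + \sum_(i < cr d0) chain_rank (jordan (crk i) (0%R : F)) a j)%N.
    case=> m0 n0 _ mu0; rewrite chain_rank_canon; congr (_ + _ + _)%N.
      by apply: eq_bigr => i _; rewrite chain_rank_Hmx //; case: (mu0 i).
    by apply: eq_bigr => i _; rewrite chain_rank_Gamma.
  have := chain_rank_congr a j c; rewrite !e //.
  rewrite (sum_bij (fun r => chain_rank (jordan r (0 : F)) a j) bsr hsr).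
  by move/addIn.
have second d0 a t : (reg d0 a t + reg d0 a t.+2 + (cH d0 a t.+1 + cG d0 a t.+1)
    = reg d0 a t.+1 + reg d0 a t.+1)%N.
  rewrite /reg /cH /cG.
  have := sum_minn (fun i => (a == (cmu i)^-1) + (a == cmu i))%N (@cm _ d0) t.
  have := sum_minn (fun i => nat_of_bool (a == (-1) ^+ (cn i).-1)) (@cn _ d0) t.
  move=> /= h1 h2; rewrite [X in (X + _)%N = _]addnACA [LHS]addnACA h1 h2.
  exact: addnACA.
have eqc a t : (0 < t)%N -> (cH d a t + cG d a t = cH d' a t + cG d' a t)%N.
  case: t => // t _; have := second d a t; have := second d' a t.
  by rewrite !eqreg; lia.
have [m0 n0 _ mu0] := ad; have [m0' n0' _ mu0'] := ad'.
have cH0 d0 t : admissible d0 -> (0 < t)%N -> cH d0 ((-1) ^+ t.-1) t = 0%N.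
  case: t => // t [_ _ _ mu] _; apply: big1 => i _.
  case: (cm i =P t.+1) => [e|]; rewrite ?muln0 //.
  have [_] := mu i; rewrite e !exprS mulrA mulrNN !mul1r /= => ne.
  rewrite [_ == cmu i]eq_sym (negPf ne) addn0 muln1.
  case: eqP => // e'; case/eqP: ne.
  by rewrite -[LHS]invrK -e' -exprVn invrN1.
have eqG t : (0 < t)%N ->
    (\sum_(i < cq d) (cn i == t) = \sum_(i < cq d') (cn i == t))%N.
  move=> t0; have := eqc ((-1) ^+ t.-1) t t0; rewrite !cH0 // !add0n.
  have e d0 : cG d0 ((-1) ^+ t.-1) t = (\sum_(i < cq d0) (cn i == t))%N.
    by apply: eq_bigr => i _; case: (cn i =P t) => [->|]; rewrite ?eqxx ?muln0.
  by rewrite !e.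
have bG : exists2 s : 'I_(cq d) -> 'I_(cq d'), bijective s & forall j, cn (s j) = cn j.
  by apply: exists_bij_of_counts => i; apply: eqG.
split=> //; have [sg bsg hsg] := bG.
have eqH a t : (0 < t)%N -> cH d a t = cH d' a t.
  move=> t0; have := eqc a t t0; rewrite /cG.
  rewrite (sum_bij (fun r => (a == (-1) ^+ r.-1) * (r == t))%N bsg hsg).
  by move/addIn.
pose key (d0 : canon_data F) (i : 'I_(cp d0)) := (cm i, cmu i + (cmu i)^-1).
have cHkey d0 a t : admissible d0 -> a != 0 -> cH d0 a t =
    ((a == a^-1).+1 * \sum_(i < cp d0) (key d0 i == (t, a + a^-1)%R))%N.
  case=> _ _ _ mu a0; rewrite big_distrr; apply: eq_bigr => i _ /=.
  have [b0 _] := mu i; rewrite xpair_eqE addrV_eq //.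
  rewrite andbC; case: (cm i == t); rewrite ?muln0 ?andbF ?muln0 // andbT muln1.
  have [e|ne] := eqVneq a (cmu i); first by rewrite e; case: eqP.
  have [e|ne'] := eqVneq a (cmu i)^-1; last by rewrite muln0.
  by have -> : (a == a^-1) = false by rewrite {2}e invrK; apply: negPf.
have eqkey a t : (0 < t)%N -> a != 0 ->
    (\sum_(i < cp d) (key d i == (t, a + a^-1)%R) =
     \sum_(i < cp d') (key d' i == (t, a + a^-1)%R))%N.
  move=> t0 a0; have := eqH a t t0; rewrite !cHkey // => /eqP.
  by rewrite eqn_pmul2l // => /eqP.
have [s bs hs] : exists2 s : 'I_(cp d) -> 'I_(cp d'), bijective s &
    forall i, key d' (s i) = key d i.
  by apply: exists_bij_of_counts => i; apply: eqkey => //;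
    [case: (mu0 i) | case: (mu0' i)].
exists s => // i; have [-> /eqP] := hs i; split=> //.
move: (hs i) => [_ /eqP]; rewrite addrV_eq; [|by case: (mu0 i)|by case: (mu0' (s i))].
case/orP=> /eqP e; first by left.
by right; rewrite e invrK.
Qed.

Lemma same_summands_congruent d d' : admissible d -> same_summands d d' ->
  congruent (canon d) (canon d').
Proof.
case=> m0 _ _ mu0 [[s bs hs] [t bt ht] [u bu hu]].
apply: congruent_dsum; first apply: congruent_dsum.
- apply: (mxdiag_congr bs) => i; have [-> [->|->]] := hs i.
    exact: congruent_refl.
  by apply: Hmx_inv_congruent => //; case: (mu0 i).
- by apply: (mxdiag_congr bt) => i; rewrite ht; apply: congruent_refl.
- by apply: (mxdiag_congr bu) => i; rewrite hu; apply: congruent_refl.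
Qed.

Lemma congruent_canonP d d' : admissible d -> admissible d' ->
  congruent (canon d) (canon d') <-> same_summands d d'.
Proof.
move=> ad ad'; split; last exact: same_summands_congruent.
move=> c; have [h1 h2] := regular_part_unique ad ad' c.
by split=> //; apply: nilpotent_part_unique.
Qed.

End Canonical.

(** * From pairs to congruence *)

Section Assembly.
Variable F : closedFieldType.
Hypothesis two_neq0 : 2%:R != 0 :> F.
Implicit Types d : canon_data F.

Lemma mxdiag_tnth (T : Type) (dim : T -> nat) (M : forall t, 'M[F]_(dim t)) s :
  congruent (\mxdiag_(i < size s) M (tnth (in_tuple s) i)) (bdiag M s).
Proof.
apply: congruent_trans (mxdiag_bdiag _) _.
have := @bdiag_congr F _ _ _ (fun i => M (tnth (in_tuple s) i)) _ M
  (tnth (in_tuple s)) (enum 'I_(size s)) (fun i => congruent_refl _).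
by rewrite map_tnth_enum.
Qed.

Lemma exists_canon n (A : 'M[F]_n) :
  exists d, admissible d /\ congruent A (canon d).
Proof.
have [r [R [js [uR js1 c]]]] := regularization A.
have [hs [gs [hs1 gs1 c']]] := regular_canonical two_neq0 uR.
exists (@CanonData _ (size hs) (fun i => (tnth (in_tuple hs) i).1)
  (fun i => (tnth (in_tuple hs) i).2) (size gs) (tnth (in_tuple gs))
  (size js) (tnth (in_tuple js))); split.
  split=> /= i.
  - by have /and3P[] := allP hs1 _ (mem_tnth i (in_tuple hs)).
  - by have := allP gs1 _ (mem_tnth i (in_tuple gs)).
  - by have := allP js1 _ (mem_tnth i (in_tuple js)).
  - by have /and3P[] := allP hs1 _ (mem_tnth i (in_tuple hs)).
apply: congruent_trans c _; apply: congruent_dsum.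
  apply: congruent_trans c' _; apply: congruent_dsum; apply: congruent_sym.
    exact: (mxdiag_tnth (@H_block F)).
  exact: mxdiag_tnth.
exact: congruent_sym (mxdiag_tnth _ _).
Qed.

Lemma mxdiag_unit p (dim : 'I_p -> nat) (M : forall i, 'M[F]_(dim i)) :
  (forall i, M i \in unitmx) -> \mxdiag_(i < p) M i \in unitmx.
Proof.
move=> uM; rewrite -row_free_unit /row_free rank_mxdiag; apply/eqP.
by apply: eq_bigr => i _; apply/eqP; rewrite -/(row_free _) row_free_unit.
Qed.

Lemma reg_part_unit d : admissible d -> reg_part d \in unitmx.
Proof.
case=> m0 n0 _ mu0; rewrite dsum_unit !mxdiag_unit // => i.
  by case: (cn i) (n0 i) => // n _; apply: Gamma_unit.
by have [] := Hmx_cosquare (cm i) (proj1 (mu0 i)).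
Qed.

Lemma pair_congruent n (E Q D1 D2 : 'M[F]_n) : Q \in unitmx -> D2 \in unitmx ->
  (exists U V, [/\ U \in unitmx, V \in unitmx, U *m E *m V = D1
                 & (invmx U)^T *m Q *m V = D2]) <->
  congruent (E *m invmx Q) (D1 *m invmx D2).
Proof.
move=> uQ uD2; split=> [[U [V [uU uV <- eD2]]]|[S [T [ST TS e]]]].
  exists (invmx U), U; rewrite mulmxV // mulVmx //; split=> //.
  have uUT : (invmx U)^T \in unitmx by rewrite unitmx_tr unitmx_inv.
  have -> : Q = invmx (invmx U)^T *m D2 *m invmx V.
    by rewrite -eD2 !mulmxA mulVmx // mul1mx mulmxK.
  apply: (can_inj (mulmxK (_ : invmx (invmx U)^T *m D2 *m invmx V \in unitmx))).
    by rewrite !unitmx_mul !unitmx_inv uUT uD2.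
  rewrite mulmxKV ?unitmx_mul ?unitmx_inv ?uUT ?uD2 //.
  rewrite !mulmxA mulVmx // mul1mx -(mulmxA _ (invmx U)^T) mulmxV // mulmx1.
  by rewrite mulmxKV // mulmxK.
have [uS uT] := mulmx1_unit ST.
have eT : T = invmx S by rewrite -[T]mul1mx -(mulVmx uS) -mulmxA ST mulmx1.
exists T, (invmx Q *m T^T *m D2); split=> //.
- by rewrite !unitmx_mul unitmx_inv uQ unitmx_tr uT.
- rewrite !mulmxA -(mulmxA T) e !mulmxA TS mul1mx -(mulmxA _ S^T) -trmx_mul TS.
  by rewrite trmx1 mulmx1 mulmxKV.
- by rewrite eT invmxK !mulmxA mulmxK // -trmx_mul -eT TS trmx1 mul1mx.
Qed.

Lemma cast_pair_id n (P : 'M[F]_n * 'M[F]_n) : cast_pair erefl P = P.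
Proof. by case: P => A B; rewrite /cast_pair /= !castmx_id. Qed.

Lemma invmx_trK n (U : 'M[F]_n) : (invmx (invmx U)^T)^T = U.
Proof. by rewrite [LHS]trmx_inv trmxK invmxK. Qed.

Lemma reduces_to_canon_E n (E Q : 'M[F]_n) d : E \in unitmx ->
  reduces_to (E, Q) (canon_E d) <-> congruent (Q *m invmx E) (canon d).
Proof.
move=> uE; have key (h : cdim d = n) : reduces_to (E, Q) (canon_E d) <->
    congruent (Q *m invmx E) (canon d).
  subst n; have P := pair_congruent Q (canon d) uE (unitmx1 _ _).
  rewrite invmx1 mulmx1 in P.
  split=> [[h [U [V [uU uV]]]]|/P[U [V [uU uV e1 e2]]]].
    rewrite (eq_irrelevance h erefl) cast_pair_id => -[e1 e2]; apply/P.
    by exists (invmx U)^T, V; rewrite unitmx_tr unitmx_inv invmx_trK.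
  exists erefl, (invmx U)^T, V; rewrite unitmx_tr unitmx_inv; split=> //.
  by rewrite cast_pair_id /act /= invmx_trK e1 e2.
split=> [r|c]; apply key => //; first by case: r.
exact: esym (congruent_dim c).
Qed.

Lemma reduces_to_canon_Q n (E Q : 'M[F]_n) d : admissible d -> Q \in unitmx ->
  reduces_to (E, Q) (canon_Q d) <-> congruent (E *m invmx Q)^T (canon d).
Proof.
move=> ad uQ; have uR := reg_part_unit ad.
have uD2 : (canon_Q d).2 \in unitmx by rewrite dsum_unit uR unitmx1.
have trC : congruent ((canon_Q d).1 *m invmx (canon_Q d).2) (canon d)^T.
  rewrite /canon /= invmx_dsum ?unitmx1 // invmx1 mul_dsum mul1mx mulmx1 tr_dsum.
  rewrite tr_mxdiag; apply: congruent_dsum (congruent_refl _).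
  apply: congruent_sym; exists (reg_part d), (invmx (reg_part d)).
  by rewrite mulmxV // mulVmx // mul1mx.
have key (h : cdim d = n) : reduces_to (E, Q) (canon_Q d) <->
    congruent (E *m invmx Q)^T (canon d).
  subst n; split=> [[h [U [V [uU uV]]]]|c].
    rewrite (eq_irrelevance h erefl) cast_pair_id => -[e1 e2].
    rewrite -[canon d]trmxK; apply: congruent_tr; apply: congruent_trans trC.
    by apply/(pair_congruent _ _ uQ uD2); exists U, V.
  have [|U [V [uU uV e1 e2]]] := proj2 (pair_congruent E (canon_Q d).1 uQ uD2).
    rewrite -[E *m _]trmxK; apply: congruent_trans (congruent_sym trC).
    exact: congruent_tr.
  by exists erefl, U, V; rewrite cast_pair_id /act /= e1 e2.
split=> [r|c]; apply key => //; first by case: r.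
exact: esym (congruent_dim c).
Qed.

Lemma canon_unit_dim_nil d : admissible d -> canon d \in unitmx -> dim_nil d = 0%N.
Proof.
move=> ad uC; have [_ _ r0 _] := ad.
have [e _] := chain_rank_canon0 two_neq0 1 ad.
have [e0 _] := chain_rank_unit0 1 uC.
move: e; rewrite e0 => /esym/eqP; rewrite sum_nat_eq0 => /forallP h.
apply: big1 => i _; have := h i; rewrite chain_rank_jordanS r0.
by rewrite addn1.
Qed.

Lemma canon_EQ d : dim_nil d = 0%N -> canon_E d = canon_Q d.
Proof.
have eq0 k (A B : 'M[F]_k) : k = 0%N -> A = B.
  by move=> k0; subst k; rewrite [A]flatmx0 [B]flatmx0.
move=> d0; rewrite /canon_E /canon_Q; congr (_, _).
  by rewrite -dsum1; congr dsum; apply: eq0.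
by congr dsum; apply: eq0.
Qed.

Theorem pair_canonical_form n (E Q : 'M[F]_n) :
    E \in unitmx \/ Q \in unitmx ->
  (exists (U V : 'M[F]_n) d (h : cdim d = n),
     [/\ U \in unitmx, V \in unitmx, admissible d,
         E \in unitmx ->
           (U *m E *m V, (invmx U)^T *m Q *m V) = cast_pair h (canon_E d)
       & Q \in unitmx ->
           (U *m E *m V, (invmx U)^T *m Q *m V) = cast_pair h (canon_Q d)])
  /\ (E \in unitmx -> forall d d' : canon_data F,
        admissible d -> admissible d' -> reduces_to (E, Q) (canon_E d) ->
        (reduces_to (E, Q) (canon_E d') <-> same_summands d d'))
  /\ (Q \in unitmx -> forall d d' : canon_data F,
        admissible d -> admissible d' -> reduces_to (E, Q) (canon_Q d) ->
        (reduces_to (E, Q) (canon_Q d') <-> same_summands d d')).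
Proof.
have uniq m (A : 'M[F]_m) d d' : admissible d -> admissible d' ->
    congruent A (canon d) -> congruent A (canon d') <-> same_summands d d'.
  move=> ad ad' c; rewrite -(congruent_canonP two_neq0 ad ad').
  by split=> [|c']; [apply: congruent_trans (congruent_sym c) |
    apply: congruent_trans c'].
move=> hEQ; split; last first.
  split=> [uE|uQ] d d' ad ad'.
    by rewrite !reduces_to_canon_E //; apply: uniq.
  by rewrite !reduces_to_canon_Q //; apply: uniq.
have [uE|nuE] := boolP (E \in unitmx).
  have [d [ad c]] := exists_canon (Q *m invmx E).
  have [h [U [V [uU uV e]]]] := proj2 (reduces_to_canon_E Q d uE) c.
  exists U, V, d, h; split=> // uQ; rewrite -canon_EQ //.
  apply: canon_unit_dim_nil => //.
  by rewrite -(congruent_unit c) unitmx_mul uQ unitmx_inv.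
have uQ : Q \in unitmx by case: hEQ => // uE; rewrite uE in nuE.
have [d [ad c]] := exists_canon (E *m invmx Q)^T.
have [h [U [V [uU uV e]]]] := proj2 (reduces_to_canon_Q E ad uQ) c.
by exists U, V, d, h.
Qed.

End Assembly.

Theorem theorem3p2 (R : realType) (n : nat) (E Q : 'M[R[i]]_n)
    (hEQ : E \in unitmx \/ Q \in unitmx) :
  (exists (U V : 'M[R[i]]_n) (d : canon_data R[i]) (h : cdim d = n),
     [/\ U \in unitmx, V \in unitmx, admissible d,
         E \in unitmx ->
           (U *m E *m V, (invmx U)^T *m Q *m V) = cast_pair h (canon_E d)
       & Q \in unitmx ->
           (U *m E *m V, (invmx U)^T *m Q *m V) = cast_pair h (canon_Q d)])
  /\ (E \in unitmx -> forall d d' : canon_data R[i],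
        admissible d -> admissible d' -> reduces_to (E, Q) (canon_E d) ->
        (reduces_to (E, Q) (canon_E d') <-> same_summands d d'))
  /\ (Q \in unitmx -> forall d d' : canon_data R[i],
        admissible d -> admissible d' -> reduces_to (E, Q) (canon_Q d) ->
        (reduces_to (E, Q) (canon_Q d') <-> same_summands d d')).
Proof.
by apply: pair_canonical_form => //; rewrite Num.Theory.pnatr_eq0.
Qed.
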